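(* Assume (EDR) with $\beta>1$, embedding index $\alpha_0$ with $\frac1\beta\le\alpha_0<1$, (Source) with $0<s\le2\tau$ and $R>0$, and (Noise) with $\sigma,L$. Let $\nu>0$, $t>0$, let $(x_i,y_i)_{i=1}^n$ be i.i.d. from $\rho$, set $\xi(x,y)=T_\nu^{-1/2}(K_xy-T_xf_\nu)$, $\xi_i=\xi(x_i,y_i)$, and $\Omega_0=\{x\in\mathcal X:|f_\rho^*(x)|\le t\}$, where $f_\rho^*(x)=\int_{\mathcal Y}y\,d\rho(y|x)$ pointwise. Then for any $\alpha_0<\alpha\le1$ and all $\delta\in(0,1)$, with probability at least $1-\delta$, $$\Big\|\frac1n\sum_{i=1}^n\xi_i\mathbf 1_{x_i\in\Omega_0}-\mathbb E\big[\xi(x,y)\mathbf 1_{x\in\Omega_0}\big]\Big\|_{\mathcal H}\le\ln\frac2\delta\Big(\frac{C_1\nu^{\alpha/2}}{n}\tilde M+\frac{C_2\mathcal N(\nu)^{1/2}}{\sqrt n}+\frac{C_3\nu^{\frac{\alpha-s}{2}}}{\sqrt n}\Big),$$ where $\tilde M=M_\alpha(E+F_\tau)R\nu^{\frac{\alpha-s}{2}}+t+L$, $C_1=8\sqrt2M_\alpha$, $C_2=8\sigma$, $C_3=8\sqrt2M_\alpha F_\tau R$.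
   Context: Setting: $\mathcal X\subseteq\mathbb R^d$ compact, $\mathcal Y\subseteq\mathbb R$, $\rho$ on $\mathcal X\times\mathcal Y$ with $\int y^2d\rho<\infty$, marginal $\mu$, $L^p=L^p(\mathcal X,\mu)$. $\mathcal H$ separable RKHS with continuous kernel $k$, $\sup_xk(x,x)\le\kappa^2$. $S_k:\mathcal H\to L^2$ inclusion, $L_k=S_kS_k^*=\sum_i\lambda_i\langle\cdot,e_i\rangle_{L^2}e_i$ ($\lambda_i$ positive non-increasing, $\{e_i\}$ ONB of $\overline{\operatorname{ran}S_k}$, $\{\lambda_i^{1/2}e_i\}$ ONB of $\mathcal H$), $T=S_k^*S_k$, $T_\nu=T+\nu^{-1}I$. $[\mathcal H]^s=\{\sum a_i\lambda_i^{s/2}e_i:(a_i)\in\ell^2\}$, $\|\sum a_i\lambda_i^{s/2}e_i\|_{[\mathcal H]^s}=\|(a_i)\|_{\ell^2}$. $M_\alpha$ is the smallest $A\ge0$ with $\sum_i\lambda_i^\alpha e_i(x)^2\le A^2$ $\mu$-a.e. $\mathcal N(\nu)=\sum_i\frac{\lambda_i}{\lambda_i+\nu^{-1}}$. $K_x:y\mapsto yk(x,\cdot)$, $K_x^*f=f(x)$, $T_x=K_xK_x^*$. Filter function: $\varphi_\nu:[0,\kappa^2]\to\mathbb R^+$ with $\sup_zz^\alpha\varphi_\nu(z)\le E\nu^{1-\alpha}$ for $\alpha\in[0,1]$ and, for some $\tau\ge1$, $\sup_z|1-z\varphi_\nu(z)|z^\alpha\le F_\tau\nu^{-\alpha}$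 for $\alpha\in[0,\tau]$. $f_\nu=\varphi_\nu(T)S_k^*f_\rho^*$. (EDR): $ci^{-\beta}\le\lambda_i\le Ci^{-\beta}$. Embedding index $\alpha_0=\inf\{\alpha\in[\frac1\beta,1]:M_\alpha<\infty\}$. (Source): $\|f_\rho^*\|_{[\mathcal H]^s}\le R$. (Noise): $\epsilon=y-f_\rho^*(x)$ satisfies $\mathbb E(|\epsilon|^m\mid x)\le\frac12m!\sigma^2L^{m-2}$ for all $m\ge2$, $\mu$-a.e. *)

(* Defs.v *)
From HB Require Import structures.
From mathcomp Require Import all_boot all_order all_algebra.
From mathcomp Require Import all_classical all_reals all_analysis.
Set Implicit Arguments. Unset Strict Implicit. Unset Printing Implicit Defensive.
Import Order.TTheory GRing.Theory Num.Def Num.Theory.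
Import numFieldNormedType.Exports.
Local Open Scope classical_set_scope.
Local Open Scope ring_scope.

Definition Rd (R : realType) (d : nat) := g_sigma_algebraType (@open 'rV[R]_d).

Definition rsum (R : realType) (u : nat -> R) : R :=
  limn (fun N => \sum_(i < N) u i).

(* Hilbert norm of an element of H given by its coordinates in the ONB
   (lambda_i^{1/2} e_i)_i of H; +oo if the coordinates are not in l^2. *)
Definition Hnorm (R : realType) (v : nat -> R) : \bar R :=
  match (\sum_(i <oo) ((v i) ^+ 2)%:E)%E with
  | r%:E => (Num.sqrt r)%:E
  | _ => +oo%E
  end.

Definition L2inner (R : realType) d (T : measurableType d)
  (mu : {measure set T -> \bar R}) (f g : T -> R) : R :=
  Rintegral mu setT (fun x => f x * g x).

Definition Malpha (R : realType) d (T : measurableType d)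
  (mu : {measure set T -> \bar R}) (lam : nat -> R) (e : nat -> T -> R)
  (alpha : R) : \bar R :=
  ereal_inf [set (A%:E)%E | A in [set A : R | 0 <= A /\
     {ae mu, forall x, (\sum_(i <oo) ((lam i `^ alpha * e i x ^+ 2)%:E) <= (A ^+ 2)%:E)%E}]].

Definition emb_index (R : realType) d (T : measurableType d)
  (mu : {measure set T -> \bar R}) (lam : nat -> R) (e : nat -> T -> R)
  (beta : R) : R :=
  inf [set alpha : R | beta^-1 <= alpha <= 1 /\ (Malpha mu lam e alpha < +oo)%E].

Definition eff_dim (R : realType) (lam : nat -> R) (nu : R) : R :=
  rsum (fun i => lam i / (lam i + nu^-1)).

(* f_nu = phi_nu(T) S_k^* f_rho^*, evaluated pointwise:
   its i-th coordinate in the ONB (lambda_i^{1/2} e_i) of H is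
   phi_nu(lambda_i) lambda_i^{1/2} <f, e_i>_{L^2}. *)
Definition fnu_coord (R : realType) d (T : measurableType d)
  (mu : {measure set T -> \bar R}) (lam : nat -> R) (e : nat -> T -> R)
  (phi : R -> R -> R) (nu : R) (f : T -> R) (i : nat) : R :=
  phi nu (lam i) * Num.sqrt (lam i) * L2inner mu f (e i).

Definition fnu (R : realType) d (T : measurableType d)
  (mu : {measure set T -> \bar R}) (lam : nat -> R) (e : nat -> T -> R)
  (phi : R -> R -> R) (nu : R) (f : T -> R) (x : T) : R :=
  rsum (fun i => fnu_coord mu lam e phi nu f i * (Num.sqrt (lam i) * e i x)).

(* i-th coordinate of xi(x,y) = T_nu^{-1/2} (K_x y - T_x f_nu), using
   k(x,.) = sum_i (lambda_i^{1/2} e_i(x)) (lambda_i^{1/2} e_i),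
   T_nu^{-1/2} (lambda_i^{1/2} e_i) = (lambda_i + nu^-1)^{-1/2} (lambda_i^{1/2} e_i). *)
Definition xi_coord (R : realType) d (T : measurableType d)
  (mu : {measure set T -> \bar R}) (lam : nat -> R) (e : nat -> T -> R)
  (phi : R -> R -> R) (nu : R) (f : T -> R) (i : nat) (z : T * R) : R :=
  (z.2 - fnu mu lam e phi nu f z.1) * (Num.sqrt (lam i) * e i z.1)
    / Num.sqrt (lam i + nu^-1).

Definition mutual_indep d (Omega : measurableType d) (R : realType)
  (P : probability Omega R) dT (T : measurableType dT) (n : nat)
  (Z : 'I_n -> Omega -> T) : Prop :=
  forall A : 'I_n -> set T, (forall j, measurable (A j)) ->
    fine (P (\bigcap_(j in [set: 'I_n]) (Z j @^-1` A j))) =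
    \prod_(j < n) fine (P (Z j @^-1` A j)).

(* Main.v *)
(** The vectors are controlled coordinate-wise: for each N the first N
    coordinates give a sum of i.i.d. vectors of R^N, whose deviation is bounded
    by a constant independent of N; the exceptional events increase with N.

    The Bernstein inequality in R^N follows Pinelis.  For Y centred,
      E cosh |x + Y| <= cosh |x| * E (exp |Y| - |Y|),
    because cosh |x + y| is at most
      cosh |x| (exp |y| - |y|) + (sinh |x| / |x|) <x, y>,
    so E cosh (theta |S_n|) is at most the n-th power of
    E (exp (theta |Y|) - theta |Y|), and Markov's inequality applies.

    For xi, one writes |y - f_nu| <= |eps| + |f* - f_nu|, where
    |T_nu^(-1/2) k_x|^2 = sum_i lambda_i e_i(x)^2 / (lambda_i + 1/nu) is at most
    M_alpha^2 nu^alpha and has mean N(nu).  On Omega_0 the residual f* - f_nu is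
    bounded (by t plus the sup norm of f_nu when s <= alpha, and by the
    embedding of [H]^alpha applied to f* - f_nu itself when s > alpha), and its
    L^2 norm is at most sqrt 2 F R nu^(-s/2).  This gives the moment condition
    with B = 2 M_alpha nu^(alpha/2) (D + L) and
    S = sqrt 2 sigma N(nu)^(1/2) + 2 M_alpha F R nu^((alpha-s)/2). *)

Require Import Defs.
From HB Require Import structures.
From mathcomp Require Import all_boot all_order all_algebra.
From mathcomp Require Import all_classical all_reals all_analysis.
From mathcomp Require Import measurable_realfun ring lra.
Set Implicit Arguments. Unset Strict Implicit. Unset Printing Implicit Defensive.
Import Order.TTheory GRing.Theory Num.Def Num.Theory.
Import numFieldNormedType.Exports.
Local Open Scope classical_set_scope.
Local Open Scope ring_scope.

(** Working with coordinates turns the expectation into a sequence of scalar integrals, so no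
    vector-valued integral occurs.

    Two obstacles shape the analytic part. The function [fnu] is a pointwise series, with a default
    value where it diverges, whereas [fstar] is known only as an L^2 limit: the embedding yields
    convergence almost everywhere, and Fatou's lemma then carries the L^2 information to the
    pointwise limits. The noise condition is available only integrated over products of a set of
    inputs with the whole line, so it must first be extended from sets to weights depending on [x].

    Truncation to [Omega0] matters when [s < alpha]: [fstar] need not be bounded there, although the
    filter makes [f_nu] bounded.

    The moment condition concerns the uncentred vectors, and centring doubles the argument of the
    exponential. In the moments, the m-th power of a sum of two terms costs 2^(m-1): all but one of
    these factors 2 enter the scale [B], and the remaining one enters the square of [S]. *)

Lemma ler_cvgn (R : realType) (u v : R^nat) (a b : R) : u @ \oo --> a -> v @ \oo --> b ->
  (\forall n \near \oo, u n <= v n) -> a <= b.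
Proof. by move=> ua vb uv; apply: (ler_cvg_to ua vb). Qed.

(** * Hyperbolic functions and the norm of R^N *)

Section cosh.
Context {R : realType}.
Implicit Types x u v p : R.

Definition cosh x : R := (expR x + expR (- x)) / 2.
Definition sinh x : R := (expR x - expR (- x)) / 2.

Lemma coshN x : cosh (- x) = cosh x.
Proof. by rewrite /cosh opprK addrC. Qed.

Lemma coshD x u : cosh (x + u) = cosh x * cosh u + sinh x * sinh u.
Proof. by rewrite /cosh /sinh opprD !expRD; field. Qed.

Lemma cosh_sinh x : cosh x + sinh x = expR x.
Proof. by rewrite /cosh /sinh; field. Qed.

Lemma sinhN x : sinh (- x) = - sinh x.
Proof. by rewrite /sinh opprK; field. Qed.

Lemma cosh_gt0 x : 0 < cosh x.
Proof. by rewrite divr_gt0// addr_gt0// expR_gt0. Qed.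

Lemma sinh_ge0 x : 0 <= x -> 0 <= sinh x.
Proof. by move=> x0; rewrite divr_ge0// subr_ge0 ler_expR; lra. Qed.

Lemma sinh_le_cosh x : sinh x <= cosh x.
Proof. by rewrite /sinh /cosh; have := expR_ge0 (- x); lra. Qed.

Lemma cvg_cosh x :
  series (fun m => exp_coeff x m + exp_coeff (- x) m) @ \oo --> cosh x * 2.
Proof.
rewrite divfK// seriesD; apply: cvgD; exact: is_cvg_series_exp_coeff.
Qed.

Lemma cvg_sinh x :
  series (fun m => exp_coeff x m - exp_coeff (- x) m) @ \oo --> sinh x * 2.
Proof.
rewrite divfK// seriesD seriesN; apply: cvgB; exact: is_cvg_series_exp_coeff.
Qed.

(** Writing the even terms with [m./2] shows them as powers of the square of [x], the variable in
    which convexity is used. *)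
Lemma exp_coeff_even x m : exp_coeff x m + exp_coeff (- x) m =
  if odd m then 0 else 2 * x ^+ (2 * m./2) / m`!%:R.
Proof.
rewrite /exp_coeff/= exprNn -signr_odd; case: ifPn => om.
  by rewrite expr1 mulN1r mulNr subrr.
rewrite expr0 mul1r mul2n -[in RHS](_ : m = m./2.*2)%N ?even_halfK//; first by ring.
Qed.

(** By induction: the defect in each step is [p * (1 - p) * (u - v) * (u ^+ n - v ^+ n)], whose last
    two factors have the same sign. *)
Lemma exprn_convex p u v n : 0 <= p <= 1 -> 0 <= u -> 0 <= v ->
  (p * u + (1 - p) * v) ^+ n <= p * u ^+ n + (1 - p) * v ^+ n.
Proof.
move=> /andP[p0 p1] u0 v0; elim: n => [|n IH]; first by rewrite !expr0; lra.
rewrite !exprS.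
have w0 : 0 <= p * u + (1 - p) * v.
  by rewrite addr_ge0// mulr_ge0// subr_ge0.
apply: (le_trans (ler_wpM2l w0 IH)); rewrite -subr_ge0.
rewrite [leRHS](_ : _ = (p * (1 - p)) * ((u - v) * (u ^+ n - v ^+ n))); last by ring.
apply: mulr_ge0; first by rewrite mulr_ge0// subr_ge0.
case: (leP u v) => uv.
  by rewrite mulr_le0// subr_le0// lerXn2r// nnegrE.
by rewrite mulr_ge0// subr_ge0 ?lerXn2r ?nnegrE// ltW.
Qed.

(* [cosh (sqrt u)] is a power series in [u] with nonnegative coefficients. *)
Lemma cosh_sqrt_convex p u v w : 0 <= p <= 1 ->
  w ^+ 2 = p * u ^+ 2 + (1 - p) * v ^+ 2 ->
  cosh w <= p * cosh u + (1 - p) * cosh v.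
Proof.
move=> p01 wuv; rewrite -(@ler_pM2r _ 2)//.
rewrite [leRHS](_ : _ = p * (cosh u * 2) + (1 - p) * (cosh v * 2)); last by ring.
have cz q z : q * series (fun m => exp_coeff z m + exp_coeff (- z) m) n
    @[n --> \oo] --> q * (cosh z * 2) by apply: cvgMl_tmp; exact: cvg_cosh.
apply: (ler_cvgn (cvg_cosh (x:=w)) (cvgD (cz p u) (cz (1 - p) v))).
apply: nearW => n; rewrite fctE /series/=.
rewrite !mulr_sumr -big_split/=; apply: ler_sum => m _.
rewrite !exp_coeff_even; case: ifP => _; first by lra.
rewrite !exprM wuv.
have := exprn_convex m./2 p01 (sqr_ge0 u) (sqr_ge0 v).
have f0 : 0 < m`!%:R^-1 :> R by rewrite invr_gt0 ltr0n fact_gt0.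
move: f0; move: (m`!%:R^-1) => g g0 H.
by have := ler_wpM2r (ltW g0) H; lra.
Qed.

Lemma sinh_ge x : 0 <= x -> x <= sinh x.
Proof.
move=> x0; rewrite -(@ler_pM2r _ 2)//.
apply: (ler_cvgn (cvg_cst (x * 2)) (cvg_sinh (x:=x))).
(* From two terms on, the partial sum contains the term of degree one, which already equals [x * 2];
   the later terms are nonnegative. *)
exists 2%N => // n /= n2.
rewrite /series/= (@big_cat_nat _ _ _ 2)//= big_nat_recl// big_nat1.
rewrite /exp_coeff/= !expr0 !expr1 subrr add0r -[leLHS]addr0 lerD//.
  by rewrite /= !divr1; lra.
apply: sumr_ge0 => m _; rewrite subr_ge0 ler_pM2r ?invr_gt0 ?ltr0n ?fact_gt0//.
rewrite exprNn -signr_odd; case: (odd m); rewrite ?expr0 ?mul1r// expr1 mulN1r.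
by rewrite (@le_trans _ _ 0)// ?oppr_le0 exprn_ge0.
Qed.

End cosh.

Section vec.
Context {R : realType} (N : nat).
Implicit Types x y : nat -> R.

(** Vectors are full sequences cut only by [N], so all finite-dimensional projections of one sample
    live in the same type. *)
Definition dot x y : R := \sum_(i < N) x i * y i.
Definition nrm x : R := Num.sqrt (dot x x).

Lemma dotC x y : dot x y = dot y x.
Proof. by apply: eq_bigr => i _; rewrite mulrC. Qed.

Lemma dotD x y z : dot (x \+ y) z = dot x z + dot y z.
Proof. by rewrite -big_split; apply: eq_bigr => i _; rewrite mulrDl. Qed.

Lemma dotZ a x y : dot (a \*o x) y = a * dot x y.
Proof. by rewrite mulr_sumr; apply: eq_bigr => i _; rewrite mulrA. Qed.

Lemma dot_ge0 x : 0 <= dot x x.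
Proof. by apply: sumr_ge0 => i _; rewrite -expr2 sqr_ge0. Qed.

Lemma nrm_ge0 x : 0 <= nrm x. Proof. exact: sqrtr_ge0. Qed.

Lemma nrm_sqr x : nrm x ^+ 2 = dot x x.
Proof. by rewrite sqr_sqrtr// dot_ge0. Qed.

Lemma dot_sqr_le x y : dot x y ^+ 2 <= dot x x * dot y y.
Proof.
have [y0|y0] := eqVneq (dot y y) 0.
  rewrite y0 mulr0 /dot big1 ?expr0n// => i _.
  have yy0 (j : 'I_N) : true -> 0 <= y j * y j by rewrite -expr2 sqr_ge0.
  have := psumr_eq0P yy0 y0 (i := i); move=> /(_ isT)/eqP; rewrite -expr2 sqrf_eq0 => /eqP ->.
  by rewrite mulr0.
have yp : 0 < dot y y by rewrite lt_neqAle eq_sym y0 dot_ge0.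
have := dot_ge0 ((dot y y \*o x) \+ ((- dot x y) \*o y)).
rewrite !dotD !dotZ 2!(dotC _ (_ \+ _)) !dotD !dotZ (dotC y x).
rewrite [leRHS](_ : _ = dot y y * (dot x x * dot y y - dot x y ^+ 2)); last by ring.
by rewrite pmulr_rge0// subr_ge0.
Qed.

Lemma dot_le x y : `|dot x y| <= nrm x * nrm y.
Proof.
rewrite -ler_sqr ?nnegrE ?mulr_ge0 ?nrm_ge0//.
by rewrite real_normK ?num_real// exprMn !nrm_sqr dot_sqr_le.
Qed.

Lemma nrmD_sqr x y : nrm (x \+ y) ^+ 2 = nrm x ^+ 2 + nrm y ^+ 2 + 2 * dot x y.
Proof. by rewrite !nrm_sqr dotD 2!(dotC _ (_ \+ _)) !dotD (dotC y x); ring. Qed.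

Lemma nrmZ a x : nrm (a \*o x) = `|a| * nrm x.
Proof.
by rewrite /nrm dotZ dotC dotZ mulrA -expr2 sqrtrM ?sqr_ge0// sqrtr_sqr.
Qed.

Lemma ler_nrmD x y : nrm (x \+ y) <= nrm x + nrm y.
Proof.
rewrite -ler_sqr ?nnegrE ?addr_ge0 ?nrm_ge0// nrmD_sqr.
by have := dot_le x y; rewrite ler_norml => /andP[_]; lra.
Qed.

(* For fixed norms, [cosh |x + y|] is a convex function of [<x, y>], so it
   is at most the chord between the two collinear cases. *)
Lemma cosh_nrmD x y :
  cosh (nrm (x \+ y)) <=
    cosh (nrm x) * (expR (nrm y) - nrm y) + sinh (nrm x) / nrm x * dot x y.
Proof.
have a0 := nrm_ge0 x; have b0 := nrm_ge0 y.
have d := dot_le x y; have e := nrmD_sqr x y.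
move: (nrm x) (nrm y) (dot x y) (nrm (x \+ y)) a0 b0 d e => a b d w a0 b0.
rewrite ler_norml => /andP[d1 d2] we.
(* For [a = 0] the quotient [sinh a / a] is 0 by the convention on division by zero; its value is
   harmless because Cauchy-Schwarz forces [d = 0]. *)
have [ab0|abn0] := eqVneq (a * b) 0.
  have d0 : d = 0 by apply/eqP; rewrite eq_le; lra.
  rewrite d0 mulr0 addr0.
  move: we; rewrite d0 mulr0 addr0 => we.
  have /orP[/eqP a00|/eqP b00] : (a == 0) || (b == 0) by rewrite -mulf_eq0 ab0.
    have -> : cosh w = cosh b.
      have /eqP : w ^+ 2 = b ^+ 2 by rewrite we a00 expr0n add0r.
      by rewrite eqf_sqr => /orP[] /eqP ->; rewrite ?coshN.
    rewrite a00 -cosh_sinh; have := sinh_ge b0.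
    by rewrite {2}/cosh oppr0 expR0; lra.
  have -> : cosh w = cosh a.
    have /eqP : w ^+ 2 = a ^+ 2 by rewrite we b00 expr0n addr0.
    by rewrite eqf_sqr => /orP[] /eqP ->; rewrite ?coshN.
  by rewrite b00 expR0 subr0 mulr1.
have ap : 0 < a by rewrite lt0r a0 andbT; apply: contraNneq abn0 => ->; rewrite mul0r.
have bp : 0 < b by rewrite lt0r b0 andbT; apply: contraNneq abn0 => ->; rewrite mulr0.
have abp : 0 < a * b by exact: mulr_gt0.
(* The cosine of the angle between the two vectors. With weight [(1 + c) / 2], the square of [w] is
   the mixture of those of [a + b] and [a - b]. *)
pose c := d / (a * b).
have c1 : -1 <= c by rewrite ler_pdivlMr//; lra.
have c2 : c <= 1 by rewrite ler_pdivrMr//; lra.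
have dc : d = c * (a * b) by rewrite divfK.
have p01 : 0 <= (1 + c) / 2 <= 1 by lra.
have := @cosh_sqrt_convex R _ (a + b) (a - b) w p01.
rewrite we dc => /(_ _)/le_trans; apply; first by field.
rewrite !coshD sinhN coshN -cosh_sinh.
have sa := sinh_ge0 a0; have sb := sinh_ge b0.
(* This product is exactly the claimed bound minus the chord
   [cosh a * cosh b + c * sinh a * sinh b]. *)
have Hs : 0 <= (cosh a - c * sinh a) * (sinh b - b).
  apply: mulr_ge0; last by rewrite subr_ge0.
  rewrite subr_ge0 (le_trans _ (sinh_le_cosh a))//.
  by rewrite -[leRHS]mul1r ler_wpM2r.
have -> : sinh a / a * (c * (a * b)) = c * b * sinh a by field; rewrite gt_eqF.
by lra.
Qed.

End vec.

(** * Iterating an independent sample *)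

Section iterate.
Context {R : realType} {dO dT dS : measure_display}
  {Omega : measurableType dO} {T : measurableType dT} {S : measurableType dS}.
Context (P : probability Omega R) (rho : probability T R).
Context (F : S * T -> S) (mF : measurable_fun setT F) (s0 : S).
Context (n : nat) (Z : nat -> Omega -> T).
Hypothesis mZ : forall j, measurable_fun setT (Z j).
Hypothesis Zindep : forall B : nat -> set T, (forall j, measurable (B j)) ->
  P (\bigcap_(j < n) (Z j @^-1` B j)) = (\prod_(j < n) fine (rho (B j)))%:E.

(** The state at [k] depends only on the sample points of index below [k], which is what makes it
    independent of [Z k]. *)
Fixpoint state (k : nat) (w : Omega) : S :=
  if k is k'.+1 then F (state k' w, Z k' w) else s0.

Lemma measurable_state k : measurable_fun setT (state k).
Proof.
elim: k => [|k IH]; first exact: measurable_cst.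
apply: (measurableT_comp mF (f := F) (g := fun w => (state k w, Z k w))).
exact: measurable_fun_pair.
Qed.

Let mpreZ B : (forall j, measurable (B j)) ->
  measurable (\bigcap_(j < n) (Z j @^-1` B j)).
Proof.
move=> mB; apply: bigcap_measurableType => j _.
by rewrite -[X in measurable X]setTI; exact: mZ.
Qed.

Lemma measurable_preimage d1 d2 (X : measurableType d1) (Y : measurableType d2) (f : X -> Y) A :
  measurable_fun setT f -> measurable A -> measurable (f @^-1` A).
Proof. by move=> mf mA; rewrite -[X in measurable X]setTI; exact: mf. Qed.

Definition mstate k : {mfun Omega >-> S} :=
  HB.pack (state k) (isMeasurableFun.Build _ _ _ _ (state k) (measurable_state k)).

Definition joint k w := (state k w, Z k w).
Lemma measurable_joint k : measurable_fun setT (joint k).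
Proof. by apply: measurable_fun_pair => //; exact: measurable_state. Qed.

Definition mjoint k : {mfun Omega >-> (S * T)%type} :=
  HB.pack (joint k) (isMeasurableFun.Build _ _ _ _ (joint k) (measurable_joint k)).

(* On a future event E, the joint law of [state k] and [Z k] is P(E) times a
   product measure, so independence of the future passes to [state k.+1]. *)
Definition future_indep k := forall A (B : nat -> set T), measurable A ->
  (forall j, measurable (B j)) -> (forall j, (j < k)%N -> B j = setT) ->
  P (state k @^-1` A `&` \bigcap_(j < n) (Z j @^-1` B j)) =
  (P (state k @^-1` A) * (\prod_(j < n) fine (rho (B j)))%:E)%E.

Lemma joint_law k : (k < n)%N -> future_indep k ->
  forall B : nat -> set T, (forall j, measurable (B j)) ->
  (forall j, (j <= k)%N -> B j = setT) ->
  forall C, measurable C ->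
  P (joint k @^-1` C `&` \bigcap_(j < n) (Z j @^-1` B j)) =
  ((\prod_(j < n) fine (rho (B j)))%:E * (distribution P (mstate k) \x rho) C)%E.
Proof.
move=> kn ik B mB Bk C mC.
set p := \prod_(j < n) _; pose E := \bigcap_(j < n) (Z j @^-1` B j).
have mE : measurable E by exact: mpreZ.
have p0 : 0 <= p by apply: prodr_ge0 => j _; exact: fine_ge0.
(* The case [p = 0] is separate because the restricted measure is going to be divided by [p]; the
   event [E] is then null. *)
have [p00|pn0] := eqVneq p 0.
  rewrite p00 mul0e; apply/eqP; rewrite eq_le measure_ge0 andbT.
  have <- : P E = 0%E by rewrite Zindep// -/p p00.
  apply: le_measure; rewrite ?inE//.
  by apply: measurableI => //; apply: measurable_preimage => //; exact: measurable_joint.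
have pp : 0 < p by rewrite lt0r pn0 p0.
have ip : 0 <= p^-1 by rewrite invr_ge0.
(* [P] restricted to [E], pushed forward along the pair and divided by [p], agrees with the product
   measure on rectangles, hence everywhere. *)
pose m0 : {measure set Omega -> \bar R} := mrestr P mE.
pose m1f : {measure set (S * T)%type -> \bar R} := pushforward m0 (mjoint k).
pose m1 := m1f (measurable_joint k).
pose m' : {measure set (S * T)%type -> \bar R} := mscale (NngNum ip) m1.
have m'E : forall A D, measurable A -> measurable D ->
    m' (A `*` D) = (distribution P (mstate k) A * rho D)%E.
  move=> A D mA mD.
  change (p^-1%:E * P (joint k @^-1` (A `*` D) `&` E) = P (state k @^-1` A) * rho D)%E.
  (* Since [B k] is the whole space, placing [D] at index [k] turns the rectangle into an event
     covered by [future_indep k]. *)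
  pose B' j := if j == k then D else B j.
  have mB' j : measurable (B' j) by rewrite /B'; case: ifP.
  have -> : joint k @^-1` (A `*` D) `&` E =
     state k @^-1` A `&` \bigcap_(j < n) (Z j @^-1` B' j).
    apply/seteqP; split => w /=.
      move=> [[Aw Dw] Ew]; split => // j jn; rewrite /B' /=.
      by case: eqP => [->//|_]; exact: Ew.
    move=> [Aw Bw]; split; first split => //.
      by have := Bw k kn; rewrite /B' eqxx.
    move=> j jn; have := Bw j jn; rewrite /B'/=.
    by case: eqP => // -> _; rewrite Bk.
  rewrite ik//; last first.
    by move=> j jk; rewrite /B' ltn_eqF// Bk// ltnW.
  rewrite muleCA; congr (_ * _)%E.
  rewrite (bigD1 (Ordinal kn))//= {1}/B' eqxx.
  rewrite -[rho D]fineK ?fin_num_measure// -EFinM; congr EFin.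
  have -> : \prod_(i < n | i != Ordinal kn) fine (rho (B' i)) = p.
    rewrite /p [RHS](bigD1 (Ordinal kn))//= (Bk k)// probability_setT/= mul1r.
    apply: eq_bigr => i ik'; rewrite /B' ifF//.
    by apply: contraNF ik' => /eqP ik'; apply/eqP/val_inj.
  by rewrite mulrC -mulrA divff// mulr1.
have -> := product_measure_unique m'E mC.
change (P (joint k @^-1` C `&` E) = p%:E * (p^-1%:E * P (joint k @^-1` C `&` E)))%E.
by rewrite muleA -EFinM divff// mul1e.
Qed.

Lemma future_indepP k : (k <= n)%N -> future_indep k.
Proof.
elim: k => [_|k IH kn] A B mA mB Bk.
  case: (pselect (A s0)) => As0.
    have -> : state 0 @^-1` A = setT by apply/seteqP; split.
    by rewrite setTI Zindep// probability_setT mul1e.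
  have -> : state 0 @^-1` A = set0 by apply/seteqP; split.
  by rewrite set0I measure0 mul0e.
have ik := IH (ltnW kn).
have mC : measurable (F @^-1` A) by exact: measurable_preimage.
have H := joint_law kn ik.
have -> : state k.+1 @^-1` A = joint k @^-1` (F @^-1` A) by [].
rewrite H// muleC; congr (_ * _)%E.
(* The trivial future identifies the product measure of the preimage of [A] under [F] with the
   probability that [state k.+1] lies in [A]. *)
have := H (fun=> setT) (fun=> measurableT) (fun _ _ => erefl) _ mC.
rewrite big1 ?mul1e; last by move=> j _; rewrite probability_setT.
move=> <-; congr (P _); rewrite -[RHS]setIT; congr (_ `&` _).
by apply/seteqP; split.
Qed.

Lemma integral_joint k (f : S * T -> \bar R) : (k < n)%N ->
  measurable_fun [set: S * T] f -> (forall z, (0 <= f z)%E) ->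
  (\int[P]_w f (joint k w) =
   \int[P]_w \int[rho]_z f (state k w, z))%E.
Proof.
move=> kn mf f0.
transitivity (\int[distribution P (mjoint k)]_z f z)%E.
  by rewrite ge0_integral_pushforward//; exact: measurable_joint.
transitivity (\int[distribution P (mstate k) \x rho]_z f z)%E.
  apply: eq_measure_integral => C mC _.
  have := joint_law kn (future_indepP (ltnW kn)) (fun=> measurableT) (fun _ _ => erefl) mC.
  rewrite big1 ?mul1e; last by move=> j _; rewrite probability_setT.
  move=> H; apply: etrans H.
  change (P (joint k @^-1` C) = P (joint k @^-1` C `&` \bigcap_(j < n) (Z j @^-1` setT))).
  congr (P _); rewrite -[LHS]setIT; congr (_ `&` _).
  by apply/esym/seteqP; split.
rewrite fubini_tonelli1// ge0_integral_pushforward//.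
- exact: measurable_fun_fubini_tonelli_F.
- by move=> s _; apply: integral_ge0.
Qed.

(** The inner integral over [rho] plays the role of a conditional expectation given the current
    state, so one factor [q] is collected per step. *)
Lemma integral_state_le (Phi : S -> \bar R) (q : R) : 0 <= q ->
  measurable_fun setT Phi -> (forall s, (0 <= Phi s)%E) ->
  (forall s, (\int[rho]_z Phi (F (s, z)) <= q%:E * Phi s)%E) ->
  (\int[P]_w Phi (state n w) <= (q ^+ n)%:E * Phi s0)%E.
Proof.
move=> q0 mPhi Phi0 H.
suff : forall k, (k <= n)%N ->
    (\int[P]_w Phi (state k w) <= (q ^+ k)%:E * Phi s0)%E by apply.
elim=> [_|k IH kn].
  rewrite expr0 mul1e (integral_cst P measurableT (Phi s0)).
  by rewrite [X in (_ * X)%E](_ : _ = 1%E) ?mule1//; exact: probability_setT.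
have -> : (\int[P]_w Phi (state k.+1 w) = \int[P]_w (Phi \o F) (joint k w))%E by [].
have mPF : measurable_fun [set: (S * T)%type] (Phi \o F) by exact: measurableT_comp.
rewrite (integral_joint kn mPF)//; last by move=> z; exact: Phi0.
apply: (@le_trans _ _ (\int[P]_w (q%:E * Phi (state k w)))%E).
  apply: ge0_le_integral => //.
  - by move=> w _; apply: integral_ge0 => z _; exact: Phi0.
  - have mG := @measurable_fun_fubini_tonelli_F _ _ _ _ _ rho _ mPF (fun z => Phi0 (F z)).
    exact: (measurableT_comp mG (measurable_state k)).
  - by apply: measurable_funeM; apply: measurableT_comp => //; exact: measurable_state.
  - by move=> w _; exact: H.
rewrite ge0_integralZl_EFin//; last first.
  by apply: measurableT_comp => //; exact: measurable_state.
rewrite exprS EFinM -muleA lee_wpmul2l//; exact: IH (ltnW kn).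
Qed.

End iterate.

(** * Bernstein's inequality in R^N *)

Section psi.
Context {R : realType}.
Implicit Types u v : R.

(** Its expansion at 0 has no linear term, so its expectation involves only moments of order at
    least two. *)
Definition psi u : R := expR u - u.

Lemma psi_ge1 u : 1 <= psi u.
Proof. by rewrite /psi; have := expR_ge1Dx u; lra. Qed.

Lemma ler_psi u v : 0 <= u -> u <= v -> psi u <= psi v.
Proof.
move=> u0 uv; rewrite /psi.
have -> : expR v = expR u * expR (v - u) by rewrite -expRD; congr expR; ring.
have := expR_ge1Dx u; have := expR_ge1Dx (v - u).
move: (expR u) (expR (v - u)) => x y; nra.
Qed.

Lemma psi_midpoint u v : psi (u + v) <= (psi (2 * u) + psi (2 * v)) / 2.
Proof.
rewrite /psi expRD.
have e x : expR (2 * x) = expR x ^+ 2 :> R.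
  by rewrite expr2 -expRD; congr expR; ring.
rewrite !e; move: (expR u) (expR v) => x y; have := sqr_ge0 (x - y); nra.
Qed.

Lemma psi_tangent u v : psi u + (expR u - 1) * (v - u) <= psi v.
Proof.
rewrite /psi.
have -> : expR v = expR u * expR (v - u) by rewrite -expRD; congr expR; ring.
have := expR_ge1Dx (v - u); have := expR_gt0 u.
move: (expR u) (expR (v - u)) => x y; nra.
Qed.

Lemma measurable_psi : measurable_fun setT psi.
Proof. by apply: measurable_funB => //; exact: measurable_expR. Qed.

Lemma measurable_cosh : measurable_fun setT (@cosh R).
Proof.
apply: measurable_funM; last exact: measurable_cst.
apply: measurable_funD; first exact: measurable_expR.
by apply: measurableT_comp => //; exact: measurable_expR.
Qed.

Lemma psi_series u : 0 <= u ->
  ((psi u)%:E <= 1 + \sum_(m <oo) (u ^+ m.+2 / m.+2`!%:R)%:E)%E.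
Proof.
move=> u0; set s := (\sum_(m <oo) _)%E.
have s0 : (0 <= s)%E.
  by apply: nneseries_ge0 => m _ _; rewrite lee_fin divr_ge0 ?exprn_ge0.
move: s0; case rs : s => [r| |]// r0; last by rewrite addey ?leey.
 rewrite -EFinD lee_fin /psi lerBlDr.
have H : series (exp_coeff u) @ \oo --> expR u by exact: is_cvg_series_exp_coeff.
apply: (ler_cvgn H (cvg_cst (1 + r + u))).
(* With [n.+2] terms the exponential sum splits off [1] and [u], leaving the first [n] terms of the
   shifted series. *)
exists 2%N => //= -[|[|n]]// _; rewrite /series/= !big_nat_recl//.
rewrite /exp_coeff/= expr0 expr1 !divr1 [in leLHS]addrA [leRHS]addrAC lerD2l.
rewrite -lee_fin -rs /s -sumEFin.
have := @nneseries_lim_ge R (fun m => (u ^+ m.+2 / m.+2`!%:R)%:E) xpredT 0 n.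
by apply => m _ _; rewrite lee_fin divr_ge0 ?exprn_ge0.
Qed.

End psi.

Lemma integral_prob_cst {R : realType} d (T : measurableType d) (rho : probability T R) (r : \bar R) :
  (\int[rho]_z r = r)%E.
Proof.
rewrite (integral_cst rho measurableT r) [X in (_ * X)%E](_ : _ = 1%E) ?mule1//.
exact: probability_setT.
Qed.

(** * Centring a random vector *)

Section centring.
Context {R : realType} {dT : measure_display} {T : measurableType dT}.
Context (rho : probability T R) (N : nat) (g : nat -> T -> R).
Hypothesis mg : forall i, measurable_fun setT (g i).

Definition gnrm (z : T) : R := nrm N (g ^~ z).
Definition gmean (i : nat) : R := Rintegral rho setT (g i).
Definition gcent (z : T) (i : nat) : R := g i z - gmean i.

Lemma measurable_nrm d (X : measurableType d) (f : nat -> X -> R) :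
  (forall i, (i < N)%N -> measurable_fun setT (f i)) -> measurable_fun setT (fun x => nrm N (f ^~ x)).
Proof.
move=> mf; apply: (measurableT_comp (continuous_measurable_fun (@sqrt_continuous R))).
by apply: measurable_sum => i;
  apply: measurable_funM; apply: mf.
Qed.

Lemma measurable_gnrm : measurable_fun setT gnrm.
Proof. by apply: measurable_nrm => i _. Qed.

Lemma le_gnrm i z : (i < N)%N -> `|g i z| <= gnrm z.
Proof.
move=> iN; rewrite -sqrtr_sqr; apply: ler_wsqrtr.
rewrite /dot (bigD1 (Ordinal iN))//= -expr2 lerDl.
by apply: sumr_ge0 => j _; rewrite -expr2 sqr_ge0.
Qed.

Hypothesis intw : rho.-integrable setT (EFin \o gnrm).

Lemma integrable_g i : (i < N)%N -> rho.-integrable setT (EFin \o g i).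
Proof.
move=> iN; apply: (le_integrable measurableT _ _ intw) => //=.
  exact/measurable_EFinP.
by move=> z _; rewrite lee_fin (le_trans (le_gnrm _ iN))// ler_norm.
Qed.

Lemma integrable_dot (x : nat -> R) :
  rho.-integrable setT (EFin \o (fun z => dot N x (g ^~ z))).
Proof.
rewrite (_ : _ \o _ = (fun z => \sum_(i < N) (x i)%:E * (g i z)%:E)%E).
  apply: (integrable_sum measurableT) => i _.
  apply: (integrableZl measurableT); exact: integrable_g.
by apply/funext => z /=; rewrite /dot -sumEFin; apply: eq_bigr => i _; rewrite EFinM.
Qed.

Lemma integral_dot (x : nat -> R) :
  Rintegral rho setT (fun z => dot N x (g ^~ z)) = dot N x gmean.
Proof.
rewrite /Rintegral (_ : (fun z => _) =
    (fun z => \sum_(i < N) (x i)%:E * (g i z)%:E)%E); last first.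
  by apply/funext => z /=; rewrite /dot -sumEFin; apply: eq_bigr => i _; rewrite EFinM.
rewrite integral_sum//; last first.
  by move=> i; apply: (integrableZl measurableT); exact: integrable_g.
rewrite /dot -(fineK (x := \sum_(i < N) _)%E) ; last first.
  apply/sum_fin_numP => i _ _; apply: (integrable_fin_num measurableT).
  by apply: (integrableZl measurableT); exact: integrable_g.
rewrite fineK; last first.
  apply/sum_fin_numP => i _ _; apply: (integrable_fin_num measurableT).
  by apply: (integrableZl measurableT); exact: integrable_g.
rewrite (eq_bigr (fun i : 'I_N => (x i * gmean i)%:E)) ?sumEFin// => i _.
rewrite (integralZl measurableT (integrable_g (ltn_ord i))) EFinM; congr (_ * _)%E.
by rewrite fineK// (integrable_fin_num measurableT (integrable_g (ltn_ord i))).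
Qed.

(** With [m] the mean, the squared norm of [m] is the integral of the scalar products of [m] with
    [g], hence at most the norm of [m] times the mean norm. *)
Lemma nrm_gmean_le : nrm N gmean <= Rintegral rho setT gnrm.
Proof.
have a0 : 0 <= Rintegral rho setT gnrm by apply: Rintegral_ge0 => z _; exact: nrm_ge0.
have [->//|m0] := eqVneq (nrm N gmean) 0.
have mp : 0 < nrm N gmean by rewrite lt0r m0 nrm_ge0.
rewrite -(ler_pM2l mp) -expr2 nrm_sqr -integral_dot -RintegralZl//.
apply: le_Rintegral => //.
- exact: integrable_dot.
- by rewrite (_ : _ \o _ = (fun z => (nrm N gmean)%:E * (gnrm z)%:E)%E)//; apply: integrableZl.
- by move=> z _; apply: le_trans (dot_le _ _ _); exact: ler_norm.
Qed.

(* Instead of symmetrising: psi is increasing and midpoint convex, and the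
   term psi (2 th |E g|) is absorbed by Jensen's inequality. *)
Lemma psi_centred_le (th q : R) : 0 <= th ->
  (\int[rho]_z (psi (2 * th * gnrm z))%:E <= q%:E)%E ->
  (\int[rho]_z (psi (th * nrm N (gcent z)))%:E <= q%:E)%E.
Proof.
move=> th0 Hq; set a := Rintegral rho setT gnrm.
have a0 : 0 <= a by apply: Rintegral_ge0 => z _; exact: nrm_ge0.
have mpsig c : measurable_fun setT (fun z => (psi (c * gnrm z))%:E).
  apply/measurable_EFinP; apply: (measurableT_comp measurable_psi).
  by apply: measurable_funM => //; exact: measurable_gnrm.
have mcent : measurable_fun setT (fun z => nrm N (gcent z)).
  by apply: (measurable_nrm (f := fun i z => g i z - gmean i)) => i _; exact: measurable_funB.
have psi0 u : 0 <= psi u by exact: le_trans (psi_ge1 u).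
have intpsi : rho.-integrable setT (fun z => (psi (2 * th * gnrm z))%:E).
  apply/integrableP; split => //.
  apply: le_lt_trans (ltry q); apply: le_trans Hq.
  rewrite le_eqVlt; apply/orP; left; apply/eqP; apply: eq_integral => z _.
  by rewrite gee0_abs// lee_fin psi0.
set b := 2 * th * a.
have b0 : 0 <= b by rewrite !mulr_ge0.
have ea : (\int[rho]_z (gnrm z)%:E = a%:E)%E.
  by rewrite /a /Rintegral fineK// (integrable_fin_num measurableT intw).
have Jensen : psi b <= q.
  set c := (expR b - 1) * (2 * th).
  have c0 : 0 <= c.
    by rewrite mulr_ge0 ?mulr_ge0// subr_ge0 -expR0 ler_expR.
  have mgE : measurable_fun setT (fun z => (gnrm z)%:E).
    by apply/measurable_EFinP; exact: measurable_gnrm.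
  (* The tangent inequality at [b] is arranged with nonnegative terms on both sides, the constant
     [c * a] being added on the right; it cancels after integration. *)
  have L : (\int[rho]_z ((psi b)%:E + c%:E * (gnrm z)%:E) = (psi b)%:E + c%:E * a%:E)%E.
    rewrite ge0_integralD//; last 3 first.
    - by move=> z _; rewrite lee_fin psi0.
    - by move=> z _; rewrite -EFinM lee_fin mulr_ge0// nrm_ge0.
    - exact: measurable_funeM.
    rewrite ge0_integralZl_EFin//; last by move=> z _; rewrite lee_fin nrm_ge0.
    by rewrite integral_prob_cst ea.
  have U : (\int[rho]_z ((psi (2 * th * gnrm z))%:E + (c * a)%:E) <= (q + c * a)%:E)%E.
    rewrite ge0_integralD//; last 2 first.
    - by move=> z _; rewrite lee_fin psi0.
    - by move=> z _; rewrite lee_fin mulr_ge0.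
    by rewrite integral_prob_cst EFinD leeD2r.
  have : ((psi b)%:E + c%:E * a%:E <= (q + c * a)%:E)%E.
    rewrite -L; apply: le_trans U; apply: ge0_le_integral => //=.
    - by move=> z _; rewrite -EFinM -EFinD lee_fin; apply: addr_ge0; [exact: psi0|apply: mulr_ge0 => //; exact: nrm_ge0].
    - by apply: emeasurable_funD => //; exact: measurable_funeM.
    - by apply: emeasurable_funD.
    - move=> z _; rewrite -EFinM -!EFinD lee_fin.
      by have := psi_tangent b (2 * th * gnrm z); rewrite /c /b; lra.
  by rewrite -EFinM -EFinD lee_fin lerD2r.
apply: (@le_trans _ _ (\int[rho]_z ((psi (2 * th * gnrm z) + psi b) / 2)%:E)%E).
  apply: ge0_le_integral => //=.
  - by move=> z _; rewrite lee_fin psi0.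
  - by apply/measurable_EFinP; apply: (measurableT_comp measurable_psi); exact: measurable_funM.
  - apply/measurable_EFinP; apply: measurable_funM => //; apply: measurable_funD => //.
    apply: (measurableT_comp measurable_psi); apply: measurable_funM => //; exact: measurable_gnrm.
  - move=> z _; rewrite lee_fin /b -!mulrA.
    apply: le_trans (psi_midpoint _ _); apply: ler_psi.
      by rewrite mulr_ge0// nrm_ge0.
    rewrite -mulrDr ler_wpM2l//.
    have -> : gcent z = (g ^~ z) \+ (-1 \*o gmean).
      by apply/funext => i; rewrite /gcent/= mulN1r.
    apply: le_trans (ler_nrmD _ _ _) _; rewrite nrmZ normrN1 mul1r lerD2l.
    exact: nrm_gmean_le.
rewrite (_ : (fun z => _) = (fun z => 2^-1%:E * (psi (2 * th * gnrm z))%:E + (psi b / 2)%:E)%E); last first.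
  by apply/funext => z; rewrite -EFinM -EFinD; congr EFin; lra.
rewrite ge0_integralD//; last 3 first.
- by move=> z _; rewrite -EFinM lee_fin mulr_ge0// psi0.
- exact: measurable_funeM.
- by move=> z _; rewrite lee_fin divr_ge0// psi0.
rewrite ge0_integralZl_EFin//; last by move=> z _; rewrite lee_fin psi0.
rewrite integral_prob_cst.
apply: (@le_trans _ _ (2^-1%:E * q%:E + (psi b / 2)%:E)%E).
  by rewrite leeD2r// lee_wpmul2l.
by rewrite -EFinM -EFinD lee_fin; lra.
Qed.

End centring.

Section exp_moment.
Context {R : realType} {dT : measure_display} {T : measurableType dT}.
Context (rho : probability T R).

Lemma geometric_sum_le (a x : R) n : 0 <= a -> 0 <= x < 1 ->
  \sum_(m < n) a * x ^+ m <= a / (1 - x).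
Proof.
move=> a0 /andP[x0 x1]; have y0 : 0 < 1 - x by rewrite subr_gt0.
rewrite ler_pdivlMr// -mulr_sumr -mulrA.
rewrite [X in a * X](_ : _ = 1 - x ^+ n); last first.
  elim: n => [|n IH]; first by rewrite big_ord0 mul0r expr0 subrr.
  by rewrite big_ord_recr/= mulrDl IH exprS; ring.
by rewrite -[leRHS]mulr1 ler_wpM2l// gerBl exprn_ge0.
Qed.

(** The factorial in the moment bound cancels the one in the exponential series, and the remainder
    is geometric with ratio [c * B]. *)
Lemma integral_psi_le (f : T -> R) (c S B : R) :
  measurable_fun setT f -> (forall z, 0 <= f z) ->
  0 <= c -> 0 <= B -> c * B < 1 ->
  (forall m, (2 <= m)%N ->
    (\int[rho]_z (f z ^+ m)%:E <= (m`!%:R / 2 * S ^+ 2 * B ^+ (m - 2))%:E)%E) ->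
  (\int[rho]_z (psi (c * f z))%:E <= (1 + c ^+ 2 * S ^+ 2 / 2 / (1 - c * B))%:E)%E.
Proof.
move=> mf f0 c0 B0 cB1 H.
have mterm m : measurable_fun setT (fun z => ((c * f z) ^+ m.+2 / m.+2`!%:R)%:E).
  apply/measurable_EFinP; apply: measurable_funM => //.
  by apply: measurable_funX; apply: measurable_funM.
have term0 m z : (0 <= ((c * f z) ^+ m.+2 / m.+2`!%:R)%:E)%E.
  by rewrite lee_fin divr_ge0// exprn_ge0// mulr_ge0.
have mser : measurable_fun setT
    (fun z => \sum_(m <oo) ((c * f z) ^+ m.+2 / m.+2`!%:R)%:E)%E.
  apply: (ge0_emeasurable_sum (h := fun m z => ((c * f z) ^+ m.+2 / m.+2`!%:R)%:E) (P := xpredT)) => //.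
apply: (@le_trans _ _
  (\int[rho]_z (1 + \sum_(m <oo) ((c * f z) ^+ m.+2 / m.+2`!%:R)%:E))%E).
  apply: ge0_le_integral => //.
  - by move=> z _; rewrite lee_fin (le_trans _ (psi_ge1 _)).
  - apply/measurable_EFinP; apply: (measurableT_comp measurable_psi).
    exact: measurable_funM.
  - exact: emeasurable_funD.
  - by move=> z _; apply: psi_series; rewrite mulr_ge0.
rewrite ge0_integralD//; last by move=> z _; exact: nneseries_ge0.
rewrite integral_prob_cst EFinD leeD2l//.
rewrite integral_nneseries//.
apply: lime_le; first by apply: is_cvg_nneseries => m _ _; exact: integral_ge0.
apply: nearW => n; rewrite big_mkord.
apply: (@le_trans _ _ (\sum_(m < n) (c ^+ 2 * S ^+ 2 / 2 * (c * B) ^+ m))%:E%E).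
  rewrite -sumEFin; apply: lee_sum => m _.
  have fm : 0 < m.+2`!%:R :> R by rewrite ltr0n fact_gt0.
  rewrite (_ : (fun z => _) = (fun z => (c ^+ m.+2 / m.+2`!%:R)%:E * (f z ^+ m.+2)%:E)%E); last first.
    by apply/funext => z; rewrite -EFinM exprMn; congr EFin; ring.
  rewrite ge0_integralZl_EFin//.
  - apply: (le_trans (lee_wpmul2l _ (H m.+2 isT))).
      by rewrite lee_fin divr_ge0// exprn_ge0.
    have e2 k : (k.+2 - 2 = k)%N by rewrite -addn2 addnK.
    have c2 : c ^+ m.+2 = c ^+ 2 * c ^+ m by rewrite -exprD.
    rewrite -EFinM lee_fin e2 exprMn c2.
    by rewrite le_eqVlt; apply/orP; left; apply/eqP; field; rewrite gt_eqF.
  - by move=> z _; rewrite lee_fin exprn_ge0.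
  - by apply/measurable_EFinP; exact: measurable_funX.
  - by rewrite divr_ge0// exprn_ge0.
rewrite lee_fin; apply: geometric_sum_le; last by rewrite mulr_ge0.
by rewrite divr_ge0// mulr_ge0// sqr_ge0.
Qed.

End exp_moment.

Section onestep.
Context {R : realType} {dT : measure_display} {T : measurableType dT}.
Context (rho : probability T R) (N : nat) (g : nat -> T -> R).
Hypothesis mg : forall i, measurable_fun setT (g i).
Hypothesis intw : rho.-integrable setT (EFin \o gnrm N g).

Lemma integral_dot_cent (s : nat -> R) :
  (\int[rho]_z (dot N s (gcent rho g z))%:E = 0)%E.
Proof.
have ig := integrable_dot mg intw s.
rewrite (_ : (fun z => _) = (fun z => (dot N s (g ^~ z))%:E - (dot N s (gmean rho g))%:E)%E).
  rewrite integralB_EFin//; last exact: finite_measure_integrable_cst.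
  rewrite integral_prob_cst.
  rewrite -[X in (X - _)%E]fineK ?(integrable_fin_num measurableT ig)//.
  by rewrite -/(Rintegral _ _ _) integral_dot// -EFinB subrr.
apply/funext => z; rewrite -EFinB; congr EFin.
by rewrite /dot -sumrB; apply: eq_bigr => i _; rewrite mulrBr.
Qed.

Lemma cosh_onestep (s : nat -> R) (th q : R) : 0 <= th ->
  (\int[rho]_z (psi (th * nrm N (gcent rho g z)))%:E <= q%:E)%E ->
  (\int[rho]_z (cosh (nrm N (s \+ (th \*o gcent rho g z))))%:E <= q%:E * (cosh (nrm N s))%:E)%E.
Proof.
move=> th0 Hq.
have mcent i : measurable_fun setT (fun z => gcent rho g z i) by exact: measurable_funB.
have mn : measurable_fun setT (fun z => nrm N (gcent rho g z)).
  by apply: (measurable_nrm (f := fun i z => gcent rho g z i)) => i _.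
have mpsi : measurable_fun setT (fun z => psi (th * nrm N (gcent rho g z))).
  by apply: (measurableT_comp measurable_psi); exact: measurable_funM.
have psi0 u : 0 <= psi u :> R by exact: le_trans (psi_ge1 u).
(* Nonnegativity alone would not allow the integral to be split below, because the linear term has
   no sign. *)
have ipsi : rho.-integrable setT (EFin \o (fun z => psi (th * nrm N (gcent rho g z)))).
  apply/integrableP; split; first exact/measurable_EFinP.
  apply: le_lt_trans (ltry q); apply: le_trans Hq.
  rewrite le_eqVlt; apply/orP; left; apply/eqP; apply: eq_integral => z _.
  by rewrite /= ger0_norm.
have idot : rho.-integrable setT (EFin \o (fun z => dot N s (gcent rho g z))).
  rewrite (_ : _ \o _ = (EFin \o (fun z => dot N s (g ^~ z))) \- cst (dot N s (gmean rho g))%:E)%E.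
    apply: integrableB => //; first exact: integrable_dot.
    exact: finite_measure_integrable_cst.
  apply/funext => z; rewrite /= -EFinB; congr EFin.
  by rewrite /dot -sumrB; apply: eq_bigr => i _; rewrite mulrBr.
set k := sinh (nrm N s) / nrm N s * th.
have i1 : rho.-integrable setT (fun z => (cosh (nrm N s))%:E * (psi (th * nrm N (gcent rho g z)))%:E)%E.
  exact: integrableZl.
have i2 : rho.-integrable setT (fun z => k%:E * (dot N s (gcent rho g z))%:E)%E.
  exact: integrableZl.
apply: (@le_trans _ _ (\int[rho]_z ((cosh (nrm N s))%:E * (psi (th * nrm N (gcent rho g z)))%:E
   + k%:E * (dot N s (gcent rho g z))%:E))%E).
  have pw z : (cosh (nrm N (s \+ th \*o gcent rho g z)) <= cosh (nrm N s) * psi (th * nrm N (gcent rho g z)) + k * dot N s (gcent rho g z)).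
    have := cosh_nrmD N s (th \*o gcent rho g z).
    rewrite nrmZ ger0_norm// (dotC N s) dotZ (dotC N _ s) /psi /k.
    by rewrite !mulrA.
  apply: ge0_le_integral => //.
  - by move=> z _; rewrite lee_fin ltW// cosh_gt0.
  - apply/measurable_EFinP; apply: (measurableT_comp measurable_cosh).
    apply: (measurable_nrm (f := fun i z => s i + th * gcent rho g z i)) => i _.
    by apply: measurable_funD => //; exact: measurable_funM.
  - by apply: emeasurable_funD; [exact: measurable_int i1|exact: measurable_int i2].
  - by move=> z _; rewrite -!EFinM -EFinD lee_fin.
rewrite (integralD measurableT i1 i2).
rewrite (integralZl measurableT ipsi) (integralZl measurableT idot) integral_dot_cent mule0 adde0.
by rewrite muleC lee_wpmul2r// lee_fin ltW// cosh_gt0.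
Qed.

End onestep.

(** * Exponential tail of the norm of a centred sum *)

Section tail.
Context {R : realType} {dO dT : measure_display}
  {Omega : measurableType dO} {T : measurableType dT}.
Context (P : probability Omega R) (rho : probability T R).
Context (n : nat) (Z : nat -> Omega -> T).
Hypothesis mZ : forall j, measurable_fun setT (Z j).
Hypothesis Zindep : forall B : nat -> set T, (forall j, measurable (B j)) ->
  P (\bigcap_(j < n) (Z j @^-1` B j)) = (\prod_(j < n) fine (rho (B j)))%:E.
Context (N : nat) (g : nat -> T -> R).
Hypothesis mg : forall i, measurable_fun setT (g i).
Hypothesis intw : rho.-integrable setT (EFin \o gnrm N g).

Let dev (w : Omega) (i : nat) : R := \sum_(j < n) gcent rho g (Z j w) i.

Lemma measurable_nrm_dev : measurable_fun setT (fun w => nrm N (dev w)).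
Proof.
apply: (measurable_nrm (f := fun i w => dev w i)) => i _.
apply: measurable_sum => j.
by apply: measurable_funB => //; exact: measurableT_comp.
Qed.

Let step (th : R) (sz : N.-tuple R * T) : N.-tuple R :=
  [tuple tnth sz.1 i + th * gcent rho g sz.2 i | i < N].

Let mstep th : measurable_fun setT (step th).
Proof.
apply/measurable_fun_tnthP => i.
rewrite (_ : _ \o _ = (fun sz => tnth sz.1 i + th * gcent rho g sz.2 i)); last first.
  by apply/funext => sz /=; rewrite tnth_mktuple.
apply: measurable_funD.
  exact: (measurableT_comp (measurable_tnth i) measurable_fst).
apply: measurable_funM => //; apply: measurable_funB => //.
exact: (measurableT_comp (mg i) measurable_snd).
Qed.

Lemma integral_cosh_dev (th q : R) : 0 <= th -> 0 <= q ->
  (\int[rho]_z (psi (th * nrm N (gcent rho g z)))%:E <= q%:E)%E ->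
  (\int[P]_w (cosh (th * nrm N (dev w)))%:E <= (q ^+ n)%:E)%E.
Proof.
move=> th0 q0 Hq.
pose tn (s : N.-tuple R) : nat -> R := nth 0 s.
have tnE (s : N.-tuple R) (i : 'I_N) : tn s i = tnth s i by rewrite /tn (tnth_nth 0).
(* The factor [th] is built into [step], so the final state is [th] times the deviation and the
   potential needs no parameter. *)
pose Phi (s : N.-tuple R) : \bar R := (cosh (nrm N (tn s)))%:E.
have mPhi : measurable_fun setT Phi.
  apply/measurable_EFinP; apply: (measurableT_comp measurable_cosh).
  apply: (measurable_nrm (f := fun i s => tn s i)) => i iN.
  rewrite (_ : (fun s => _) = (fun s : N.-tuple R => tnth s (Ordinal iN))); first exact: measurable_tnth.
  by apply/funext => s; rewrite -tnE.
have nrm_eq (u v : nat -> R) : (forall i : 'I_N, u i = v i) -> nrm N u = nrm N v.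
  by move=> uv; rewrite /nrm; congr Num.sqrt; apply: eq_bigr => i _; rewrite uv.
have := @integral_state_le R dO dT _ Omega T (N.-tuple R) P rho (step th) (mstep th)
  [tuple 0 | i < N] n Z mZ Zindep Phi q q0 mPhi.
have st k w : forall i : 'I_N, tn (state (step th) [tuple 0 | i < N] Z k w) i =
    th * \sum_(j < k) gcent rho g (Z j w) i.
  move=> i; elim: k => [|k IH]; first by rewrite big_ord0 mulr0 tnE /= tnth_mktuple.
  rewrite tnE/= tnth_mktuple/= -tnE IH big_ord_recr/= /gcent; ring.
move=> /(_ _)/(_ _)/le_trans H.
rewrite (_ : (fun w => _) = (fun w => Phi (state (step th) [tuple 0 | i < N] Z n w))); last first.
  apply/funext => w; rewrite /Phi; congr (EFin (cosh _)).
  by rewrite -[in LHS](ger0_norm th0) -nrmZ; apply: nrm_eq => i; rewrite st.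
apply: H.
- by move=> s; rewrite lee_fin ltW// cosh_gt0.
- move=> s; apply: le_trans (cosh_onestep mg intw (tn s) th0 Hq).
  rewrite le_eqVlt; apply/orP; left; apply/eqP; apply: eq_integral => z _.
  rewrite /Phi; congr (EFin (cosh _)); apply: nrm_eq => i.
  by rewrite tnE tnth_mktuple/= tnE.
- rewrite /Phi (_ : nrm N _ = 0); last first.
    rewrite /nrm /dot big1 ?sqrtr0// => i _.
    by rewrite tnE tnth_mktuple mul0r.
  by rewrite -EFinM lee_fin /cosh oppr0 expR0 -mulr2n divff// mulr1.
Qed.

Lemma tail_dev (th q r : R) : 0 <= th -> 0 <= q -> 0 <= r ->
  (\int[rho]_z (psi (th * nrm N (gcent rho g z)))%:E <= q%:E)%E ->
  (P [set w | (r < nrm N (dev w))%R] <= (2 * expR (- (th * r)) * q ^+ n)%:E)%E.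
Proof.
move=> th0 q0 r0 Hq; set A := [set w | _].
have mA : measurable A.
  rewrite (_ : A = (fun w => nrm N (dev w)) @^-1` `]r, +oo[%classic).
    by apply: measurable_preimage => //; exact: measurable_nrm_dev.
  by apply/seteqP; split => w /=; rewrite in_itv/= andbT.
(* Markov's inequality, with [cosh] bounded below by half the exponential: this is the source of the
   factor 2. *)
have H : ((expR (th * r) / 2)%:E * P A <= (q ^+ n)%:E)%E.
  apply: le_trans (integral_cosh_dev th0 q0 Hq).
  have -> : P A = (\int[P]_w (\1_A w)%:E)%E by rewrite integral_indic// setIT.
  have mI : measurable_fun setT (fun w => (\1_A w : R)%:E).
    by apply/measurable_EFinP; exact: measurable_indic.
  have c0 : 0 <= expR (th * r) / 2 by rewrite divr_ge0// expR_ge0.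
  have I0 w : [set: Omega] w -> (0 <= (\1_A w : R)%:E)%E by rewrite lee_fin.
  rewrite -(ge0_integralZl_EFin P measurableT I0 mI c0).
  apply: ge0_le_integral => //.
  - exact: measurable_funeM.
  - apply/measurable_EFinP; apply: (measurableT_comp measurable_cosh).
    by apply: measurable_funM => //; exact: measurable_nrm_dev.
  - move=> w _; rewrite -EFinM lee_fin indicE.
    case: (boolP (w \in A)) => [|_]; last by rewrite mulr0 ltW// cosh_gt0.
    rewrite inE /A/= => rw; rewrite mulr1.
    have e1 : expR (th * r) <= expR (th * nrm N (dev w)).
      by rewrite ler_expR ler_wpM2l// ltW.
    by rewrite /cosh ler_pM2r ?invr_gt0// (le_trans e1)// lerDl expR_ge0.
have Pp : P A = (fine (P A))%:E by rewrite fineK ?fin_num_measure.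
move: H; rewrite Pp -EFinM !lee_fin expRN; move: (fine _) (q ^+ n) => p u.
have e0 := expR_gt0 (th * r); move: (expR _) e0 => e e0 H.
rewrite -(ler_pM2l e0) [leRHS](_ : _ = 2 * u); last by field; rewrite gt_eqF.
by move: H; lra.
Qed.

End tail.

Section bernstein.
Context {R : realType} {dO dT : measure_display}
  {Omega : measurableType dO} {T : measurableType dT}.
Context (P : probability Omega R) (rho : probability T R).

Lemma ln2_ge : 2^-1 <= ln 2 :> R.
Proof.
rewrite -ler_expR lnK ?posrE//.
have := expR_ge1Dx (- 2^-1 : R); rewrite expRN => h.
have e0 := expR_gt0 (2^-1 : R).
by have := ler_wpM2l (ltW e0) h; rewrite mulfV ?gt_eqF//; lra.
Qed.

Lemma integrable_sqr (f : T -> R) (c : R) : measurable_fun setT f ->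
  (\int[rho]_z (f z ^+ 2)%:E <= c%:E)%E -> rho.-integrable setT (EFin \o f).
Proof.
move=> mf H; apply/integrableP; split; first exact/measurable_EFinP.
have mf2 : measurable_fun setT (fun z => (f z ^+ 2)%:E).
  by apply/measurable_EFinP; exact: measurable_funX.
apply: (@le_lt_trans _ _ (\int[rho]_z (1 + (f z ^+ 2)%:E))%E).
  apply: ge0_le_integral => //.
  - by apply: measurableT_comp => //; exact/measurable_EFinP.
  - exact: emeasurable_funD.
  - move=> z _; rewrite /= -EFinD lee_fin.
    have := sqr_ge0 (`|f z| - 1); rewrite -(real_normK (num_real (f z))).
    have := normr_ge0 (f z); nra.
rewrite ge0_integralD//; last by move=> z _; rewrite lee_fin sqr_ge0.
by rewrite integral_prob_cst lte_add_pinfty ?ltry// (le_lt_trans H) ?ltry.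
Qed.

Lemma bernstein (n : nat) (Z : nat -> Omega -> T) (N : nat) (g : nat -> T -> R) (S B delta : R) :
  (0 < n)%N ->
  (forall j, measurable_fun setT (Z j)) ->
  (forall A : nat -> set T, (forall j, measurable (A j)) ->
    P (\bigcap_(j < n) (Z j @^-1` A j)) = (\prod_(j < n) fine (rho (A j)))%:E) ->
  (forall i, measurable_fun setT (g i)) ->
  0 < S -> 0 <= B -> 0 < delta < 1 ->
  (forall m, (2 <= m)%N ->
    (\int[rho]_z (nrm N (g ^~ z) ^+ m)%:E <= (m`!%:R / 2 * S ^+ 2 * B ^+ (m - 2))%:E)%E) ->
  (P [set w | (5 * ln (2 / delta) * (B + S * Num.sqrt n%:R) <
      nrm N (fun i => \sum_(j < n) gcent rho g (Z j w) i))%R] <= delta%:E)%E.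
Proof.
move=> n0 mZ Zi mg S0 B0 /andP[d0 d1] H.
have mw := measurable_gnrm N mg.
have intw : rho.-integrable setT (EFin \o gnrm N g).
  exact: integrable_sqr mw (H 2 isT).
set s := S * Num.sqrt n%:R; set D := B + s.
have sqn : 0 < Num.sqrt n%:R :> R by rewrite sqrtr_gt0 ltr0n.
have s0 : 0 < s by exact: mulr_gt0.
have D0 : 0 < D by rewrite /D; lra.
(* The exponential parameter for the uncentred norm. The choice [c * D = 2^-1] keeps [c * B] below
   1; the centred sum is treated with [c / 2]. *)
pose c := (2 * D)^-1.
have c0 : 0 < c by rewrite invr_gt0 mulr_gt0.
have cD : c * D = 2^-1 by rewrite /c; field; rewrite gt_eqF.
have cB : c * B < 1.
  have : c * B <= c * D by rewrite ler_wpM2l ?(ltW c0)// /D; lra.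
  by rewrite cD; lra.
pose x := c ^+ 2 * S ^+ 2 / 2 / (1 - c * B).
have x0 : 0 <= x.
  by apply: divr_ge0; [apply: divr_ge0 => //; rewrite mulr_ge0 ?sqr_ge0|rewrite subr_ge0 ltW].
have Hpsi := @integral_psi_le R _ T rho (gnrm N g) c S B mw (fun z => nrm_ge0 N _) (ltW c0) B0 cB H.
have th0 : 0 <= c / 2 by rewrite divr_ge0 ?ltW.
have := @psi_centred_le R _ T rho N g mg intw (c / 2) (1 + x) th0.
rewrite [2 * (c / 2)](_ : _ = c); last by field.
move=> /(_ Hpsi) Hc.
have t0 : 2^-1 <= ln (2 / delta).
  apply: (le_trans ln2_ge); rewrite ler_ln ?posrE ?divr_gt0//.
  by rewrite ler_pdivlMr//; lra.
have r0 : 0 <= 5 * ln (2 / delta) * D.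
  by rewrite !mulr_ge0 ?(ltW D0)//; lra.
have q0 : 0 <= 1 + x by lra.
apply: le_trans (tail_dev mZ Zi mg intw th0 q0 r0 Hc) _.
rewrite lee_fin.
(* The left side equals [s ^+ 2 / (4 * (B + s) * (B + 2 * s))], and [(B + s) * (B + 2 * s)] is at
   least [2 * s ^+ 2]. *)
have nx : n%:R * x <= 8^-1.
  have s2 : n%:R * S ^+ 2 = s ^+ 2 by rewrite /s exprMn sqr_sqrtr ?ler0n// mulrC.
  have Bs : 0 < B + s by [].
  have B2s : 0 < B + 2 * s by lra.
  have -> : n%:R * x = s ^+ 2 / (4 * (B + s) * (B + 2 * s)).
    rewrite (_ : n%:R * x = n%:R * S ^+ 2 * (c ^+ 2 / 2 / (1 - c * B))); last first.
      by rewrite /x; ring.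
    rewrite s2 /c /D (_ : 1 - (2 * (B + s))^-1 * B = (B + 2 * s) / (2 * (B + s))).
      by field; rewrite !gt_eqF.
    by field; rewrite gt_eqF.
  rewrite ler_pdivrMr; last by rewrite !mulr_gt0//; rewrite /D in D0; lra.
  by nra.
have qn : (1 + x) ^+ n <= expR (8^-1).
  apply: (@le_trans _ _ (expR x ^+ n)).
    by rewrite lerXn2r ?nnegrE ?expR_ge0// expR_ge1Dx.
  by rewrite -expRM_natl ler_expR.
(* The origin of the 5: the exponent exceeds [ln (2 / delta)] by a quarter of it, which by [t0] is
   at least 1/8 and pays for [expR 8^-1]. *)
have -> : c / 2 * (5 * ln (2 / delta) * D) = 5 / 4 * ln (2 / delta).
  move: (ln _) => l.
  rewrite (_ : c / 2 * (5 * l * D) = 5 / 2 * l * (c * D)); last by ring.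
  by rewrite cD; field.
apply: (@le_trans _ _ (2 * expR (- (5 / 4 * ln (2 / delta))) * expR 8^-1)).
  by rewrite ler_wpM2l// mulr_ge0// expR_ge0.
rewrite -mulrA -expRD.
apply: (@le_trans _ _ (2 * expR (- ln (2 / delta)))).
  by rewrite ler_wpM2l// ler_expR; lra.
rewrite expRN lnK ?posrE ?divr_gt0// invf_div mulrC divfK//.
Qed.

End bernstein.

(** * Measure-theoretic complements *)

Section measurability_limn.
Context {R : realType} d (T : measurableType d).

(** Convergence becomes a condition on two measurable functions, so the convergence set of a
    sequence of measurable functions is measurable. *)
Lemma cvgn_limn_einf_esup (v : R^nat) : cvgn v <->
  limn_einf (EFin \o v) = limn_esup (EFin \o v) /\ limn_esup (EFin \o v) \is a fin_num.
Proof.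
split=> [cv|[e f]].
  have cE : EFin \o v @ \oo --> (limn v)%:E by apply: cvg_EFin => //; exact: nearW.
  have [-> ->] := cvg_limn_einf_sup cE; by [].
have H : EFin \o v @ \oo --> limn_esup (EFin \o v).
  apply: (@squeeze_cvge _ _ _ _ (einfs (EFin \o v)) _ (esups (EFin \o v))).
  - apply: nearW => n; apply/andP; split.
      by apply: ereal_inf_lbound; exists n => /=.
    by apply: ereal_sup_ubound; exists n => /=.
  - by rewrite -e limn_einf_lim; exact: is_cvg_einfs.
  - by rewrite limn_esup_lim; exact: is_cvg_esups.
apply/cvg_ex; exists (fine (limn_esup (EFin \o v))).
have := fine_cvg (f := EFin \o v) (a := fine (limn_esup (EFin \o v))).
by rewrite fineK// => /(_ _ _ H); exact.
Qed.

(* Where the sequence diverges, [limn] is the constant [point]. *)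
Lemma measurable_limn (u : nat -> T -> R) : (forall n, measurable_fun setT (u n)) ->
  measurable_fun setT (fun x => limn (u ^~ x)).
Proof.
move=> mu; pose E := [set x | cvgn (u ^~ x)].
have muE n : measurable_fun setT (fun x => (u n x)%:E) by exact/measurable_EFinP.
have m1 : measurable_fun setT (fun x => limn_esup (fun n => (u n x)%:E)).
  exact: (measurable_fun_limn_esup (f := fun n x => (u n x)%:E)).
have m2 : measurable_fun setT (fun x => limn_einf (fun n => (u n x)%:E)).
  rewrite (_ : (fun x => _) = (fun x => - limn_esup (fun n => (- u n x)%:E))%E); last first.
    by apply/funext => x; rewrite [in RHS](_ : (fun n => (- u n x)%:E) = -%E \o (fun n => (u n x)%:E))// limn_esupN oppeK.
  apply: measurableT_comp => //.
  apply: (measurable_fun_limn_esup (f := fun n x => (- u n x)%:E)) => n.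
  by apply/measurable_EFinP; exact: measurableT_comp.
have mE : measurable E.
  have -> : E = [set x | limn_einf (fun n => (u n x)%:E) = limn_esup (fun n => (u n x)%:E)]
      `&` ((fun x => limn_esup (fun n => (u n x)%:E)) @^-1` [set y | y \is a fin_num]).
    by apply/seteqP; split => x; rewrite /E/= => /cvgn_limn_einf_esup.
  apply: measurableI.
    rewrite -[X in measurable X]setTI; exact: measurable_eqe.
  rewrite -[X in measurable X]setTI; exact: emeasurable_fin_num.
have -> : [set: T] = E `|` ~` E by rewrite setUv.
apply/measurable_funU => //; first exact: measurableC.
split.
  by apply: (measurable_fun_cvg (h := u)) => [m|x Ex] //; exact: measurable_funS (mu m).
apply: (eq_measurable_fun (cst point)) => //.
by move=> x; rewrite inE => /= Ex; rewrite dvgP.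
Qed.

End measurability_limn.

(** * Conditional moment bounds under a weight *)

Section weighted.
Context {R : realType} d1 d2 (X : measurableType d1) (Y : measurableType d2).
Context (m : {measure set X -> \bar R}) (m2 : {measure set Y -> \bar R}).
Context (p : Y -> X) (mp : measurable_fun setT p) (f : Y -> R).
Hypothesis mf : measurable_fun setT f.
Hypothesis f0 : forall y, 0 <= f y.
Context (C : R) (C0 : 0 <= C).
Hypothesis H : forall A, measurable A -> (\int[m2]_(y in p @^-1` A) (f y)%:E <= C%:E * m A)%E.

Import HBNNSimple.

Let weighted_nnsfun (h : {nnsfun X >-> R}) :
  (\int[m2]_y ((h (p y))%:E * (f y)%:E) <= C%:E * \int[m]_x (h x)%:E)%E.
Proof.
have [s hE] : exists s : seq R, forall x, h x = \sum_(r <- s) r * \1_(h @^-1` [set r]) x.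
  by exists (finmap.enum_fset (fset_set (range h))) => x; rewrite fimfunE fsbig_finite.
have t0 r x : 0 <= r * \1_(h @^-1` [set r]) x.
  by case: (ltP r 0) => r0; [rewrite preimage_nnfun0// indic0 mulr0|rewrite mulr_ge0].
have mi r : measurable_fun setT (fun x => (r * \1_(h @^-1` [set r]) x)%:E).
  by apply/measurable_EFinP; apply: measurable_funM.
have mip r : measurable_fun setT (fun y => (r * \1_(h @^-1` [set r]) (p y))%:E).
  exact: (measurableT_comp (mi r) mp).
rewrite (_ : (fun y => _) = (fun y => \sum_(r <- s) ((r * \1_(h @^-1` [set r]) (p y))%:E * (f y)%:E))%E); last first.
  apply/funext => y; rewrite hE -sumEFin ge0_sume_distrl// => r _.
  by rewrite lee_fin.
rewrite (_ : (fun x => (h x)%:E) = (fun x => \sum_(r <- s) (r * \1_(h @^-1` [set r]) x)%:E)%E); last first.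
  by apply/funext => x; rewrite hE -sumEFin.
rewrite ge0_integral_sum//; last 2 first.
- by move=> r; apply: emeasurable_funM; [exact: mip|exact/measurable_EFinP].
- by move=> r y _; rewrite mule_ge0// lee_fin.
rewrite ge0_integral_sum//; last first.
  by move=> r x _; rewrite lee_fin.
rewrite ge0_sume_distrr; last by move=> r _; apply: integral_ge0 => x _; rewrite lee_fin.
apply: lee_sum => r _.
have [r0|r0] := ltP r 0.
  have e x : \1_(h @^-1` [set r]) x = 0 :> R.
    by rewrite preimage_nnfun0// indic0.
  rewrite integral0_eq; last by move=> y _; rewrite e mulr0 mul0e.
  by rewrite integral0_eq ?mule0// => x _; rewrite e mulr0.
have mA : measurable (h @^-1` [set r]) by [].
have -> : (\int[m]_x (r * \1_(h @^-1` [set r]) x)%:E = r%:E * m (h @^-1` [set r]))%E.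
  by rewrite integralZl_indic_nnsfun// integral_indic// setIT.
rewrite (_ : (fun y => _) = (fun y => r%:E * ((EFin \o f) \_ (p @^-1` (h @^-1` [set r]))) y)%E); last first.
  apply/funext => y; rewrite EFinM -muleA; congr (_ * _)%E.
  rewrite patchE indicE (_ : (y \in _) = (p y \in h @^-1` [set r])).
    by case: ifP; rewrite ?mul1e ?mul0e.
  by apply/idP/idP; rewrite !inE.
have mpA : measurable (p @^-1` (h @^-1` [set r])) by exact: measurable_preimage.
rewrite ge0_integralZl_EFin//.
- by rewrite -integral_mkcond muleCA lee_wpmul2l//; exact: H.
- by move=> y _; rewrite patchE; case: ifP => // _; rewrite /= lee_fin f0.
- by apply/(measurable_restrictT _ _).1 => //; apply: measurable_funTS; exact/measurable_EFinP.
Qed.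

(** A conditional bound known only on preimages of sets passes to simple weights by linearity and to
    nonnegative measurable ones by monotone convergence. *)
Lemma weighted_integral_le (w : X -> R) : measurable_fun setT w -> (forall x, 0 <= w x) ->
  (\int[m2]_y ((w (p y))%:E * (f y)%:E) <= C%:E * \int[m]_x (w x)%:E)%E.
Proof.
move=> mw w0.
have mwE : measurable_fun setT (fun x => (w x)%:E) by exact/measurable_EFinP.
pose h := nnsfun_approx measurableT mwE.
have hc x : (fun n => (h n x)%:E) @ \oo --> (w x)%:E.
  by apply: (cvg_nnsfun_approx measurableT mwE) => // y _; rewrite lee_fin.
have hnd x n k : (n <= k)%N -> h n x <= h k x.
  by move=> nk; have /lefP := nd_nnsfun_approx measurableT mwE nk; exact.
have hle n x : h n x <= w x.
  rewrite -lee_fin -(cvg_lim _ (hc x))//; apply: lime_ge.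
    by apply/cvg_ex; eexists; exact: hc.
  by exists n => // k nk; rewrite lee_fin hnd.
have mfE : measurable_fun setT (fun y => (f y)%:E) by exact/measurable_EFinP.
have mhp n : measurable_fun setT (fun y => (h n (p y))%:E * (f y)%:E)%E.
  by apply: emeasurable_funM => //; apply/measurable_EFinP; exact: measurableT_comp.
have hf0 n y : (0 <= (h n (p y))%:E * (f y)%:E)%E by rewrite mule_ge0// lee_fin.
have hfnd y n k : (n <= k)%N -> ((h n (p y))%:E * (f y)%:E <= (h k (p y))%:E * (f y)%:E)%E.
  by move=> nk; rewrite lee_wpmul2r ?lee_fin// hnd.
rewrite (_ : (fun y => _) = (fun y => limn (fun n => (h n (p y))%:E * (f y)%:E))%E); last first.
  apply/funext => y; apply/esym/cvg_lim => //.
  by apply: cvgeMr.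
rewrite (monotone_convergence m2 measurableT mhp (fun n y _ => hf0 n y) (fun y _ n k nk => hfnd y n k nk)).
apply: lime_le.
  apply: ereal_nondecreasing_is_cvgn => n k nk; apply: ge0_le_integral => //.
  by move=> y _; exact: hfnd.
apply: nearW => n; apply: (le_trans (weighted_nnsfun (h n))).
rewrite lee_wpmul2l ?lee_fin//; apply: ge0_le_integral => //.
- by move=> x _; rewrite lee_fin.
- exact/measurable_EFinP.
- by move=> x _; rewrite lee_fin hle.
Qed.

End weighted.

Section transfer.
Context {R : realType} d1 d2 (X : measurableType d1) (Y : measurableType d2).
Context (mu : {measure set X -> \bar R}) (rho : {measure set (X * Y)%type -> \bar R}).
Hypothesis hmu : forall A, measurable A -> mu A = rho (A `*` setT).

Lemma integral_marginal (w : X -> \bar R) : measurable_fun setT w -> (forall x, (0 <= w x)%E) ->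
  (\int[rho]_z w z.1 = \int[mu]_x w x)%E.
Proof.
move=> mw w0; have mfst : measurable_fun [set: (X * Y)%type] fst by exact: measurable_fst.
transitivity (\int[pushforward rho fst]_x w x)%E.
  by rewrite (ge0_integral_pushforward mfst)// => x _; exact: w0.
apply: eq_measure_integral => A mA _; rewrite hmu// /pushforward; congr (rho _).
by apply/seteqP; split => z /=; [move=> ?; split|case].
Qed.

End transfer.

(** * Orthonormal series *)

Section l2_series.
Context {R : realType}.

(** Cauchy-Schwarz is applied to absolute values, so one estimate gives both absolute convergence
    and the bound on the sum. *)
Lemma l2_series_cvg (u v : nat -> R) (U V : R) : 0 <= U -> 0 <= V ->
  (forall N, dot N u u <= U ^+ 2) -> (forall N, dot N v v <= V ^+ 2) ->
  cvgn (fun N => dot N u v) /\ `|limn (fun N => dot N u v)| <= U * V.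
Proof.
move=> U0 V0 hu hv.
have nu N : nrm N u <= U.
  by rewrite -(ger0_norm U0) -sqrtr_sqr ler_wsqrtr.
have nv N : nrm N v <= V.
  by rewrite -(ger0_norm V0) -sqrtr_sqr ler_wsqrtr.
have abs_dot N (w : nat -> R) : dot N (fun i => `|w i|) (fun i => `|w i|) = dot N w w.
  by apply: eq_bigr => i _; rewrite -normrM ger0_norm// -expr2 sqr_ge0.
have abs_le N : \sum_(i < N) `|u i * v i| <= U * V.
  have -> : \sum_(i < N) `|u i * v i| = dot N (fun i => `|u i|) (fun i => `|v i|).
    by apply: eq_bigr => i _; rewrite normrM.
  apply: (le_trans (ler_norm _)); apply: (le_trans (dot_le _ _ _)).
  by rewrite /nrm !abs_dot ler_pM ?sqrtr_ge0//; [exact: nu|exact: nv].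
have E : (fun N => dot N u v) = series (fun i => u i * v i).
  by apply/funext => N; rewrite /series/= big_mkord.
have cv : cvgn (fun N => dot N u v).
  rewrite E; apply: normed_cvg; apply: nondecreasing_is_cvgn.
    by apply: nondecreasing_series => n _ _; exact: normr_ge0.
  exists (U * V) => _ [N _ <-].
  change (\sum_(0 <= i < N) `|u i * v i| <= U * V).
  by rewrite big_mkord; exact: abs_le.
split => //.
have dl N : `|dot N u v| <= U * V.
  by apply: le_trans (abs_le N); exact: ler_norm_sum.
rewrite ler_norml; apply/andP; split.
  by apply: limr_ge => //; apply: nearW => N; have := dl N; rewrite ler_norml => /andP[].
by apply: limr_le => //; apply: nearW => N; have := dl N; rewrite ler_norml => /andP[].
Qed.

End l2_series.

Section fatou_ae.
Context {R : realType} d (T : measurableType d) (mu : {measure set T -> \bar R}).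

(** With limit [0] this identifies [f] with its pointwise series; with a positive limit it bounds
    the L^2 norm of the residual. *)
Lemma ae_fatou (f : nat -> T -> R) (g : T -> R) (K : nat -> \bar R) (k : \bar R) :
  (forall n, measurable_fun setT (f n)) -> measurable_fun setT g ->
  (forall n x, 0 <= f n x) -> (forall x, 0 <= g x) ->
  {ae mu, forall x, f ^~ x @ \oo --> g x} ->
  (forall n, (\int[mu]_x (f n x)%:E <= K n)%E) -> K @ \oo --> k ->
  (\int[mu]_x (g x)%:E <= k)%E.
Proof.
move=> mf mg f0 g0 cfg fK Kk.
have mfE n : measurable_fun setT (fun x => (f n x)%:E) by exact/measurable_EFinP.
have mE : measurable_fun setT (fun x => limn_einf (fun n => (f n x)%:E)).
  rewrite (_ : (fun x => _) = (fun x => - limn_esup (fun n => (- f n x)%:E))%E); last first.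
    apply/funext => x.
    by rewrite [in RHS](_ : (fun n => (- f n x)%:E) = -%E \o (fun n => (f n x)%:E))// limn_esupN oppeK.
  apply: measurableT_comp => //.
  apply: (measurable_fun_limn_esup (f := fun n x => (- f n x)%:E)) => n.
  by apply/measurable_EFinP; exact: measurableT_comp.
have l0 x : (0 <= limn_einf (fun n => (f n x)%:E))%E.
  rewrite limn_einf_lim; apply: lime_ge; first exact: is_cvg_einfs.
  by apply: nearW => n; apply: le_ereal_inf_tmp => _ [k0 _ <-]; rewrite lee_fin.
apply: (@le_trans _ _ (\int[mu]_x limn_einf (fun n => (f n x)%:E))%E).
  apply: ae_ge0_le_integral => //.
  - by move=> x _; rewrite lee_fin.
  - exact/measurable_EFinP.
  - apply: filterS cfg => x cx _.
    have cE : (fun n => (f n x)%:E) @ \oo --> (g x)%:E.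
      by apply: cvg_EFin => //; exact: nearW.
    by have [-> _] := cvg_limn_einf_sup cE.
apply: (le_trans (fatou mu measurableT mfE (fun n x _ => f0 n x))).
apply: (@le_trans _ _ (limn_einf K)); last by have [-> _] := cvg_limn_einf_sup Kk.
rewrite !limn_einf_lim; apply: lee_lim; [exact: is_cvg_einfs|exact: is_cvg_einfs|].
apply: nearW => n; apply: le_ereal_inf_tmp => _ [j nj <-].
by apply: le_trans (fK j); apply: ereal_inf_lbound; exists j.
Qed.

End fatou_ae.

Section orthonormal.
Context {R : realType} d (T : measurableType d) (mu : {measure set T -> \bar R}).
Context (e : nat -> T -> R).
Hypothesis me : forall i, measurable_fun setT (e i).
Hypothesis eL2 : forall i, mu.-integrable setT (fun x => ((e i x) ^+ 2)%:E).
Hypothesis orth : forall i j, L2inner mu (e i) (e j) = (i == j)%:R.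

Lemma integrable_prod (f g : T -> R) : measurable_fun setT f -> measurable_fun setT g ->
  mu.-integrable setT (fun x => ((f x) ^+ 2)%:E) ->
  mu.-integrable setT (fun x => ((g x) ^+ 2)%:E) ->
  mu.-integrable setT (fun x => (f x * g x)%:E).
Proof.
move=> mf mg if2 ig2.
apply: (le_integrable measurableT _ _ (integrableD measurableT if2 ig2)).
  by apply/measurable_EFinP; exact: measurable_funM.
move=> x _ /=; rewrite lee_fin [leRHS]ger0_norm ?addr_ge0 ?sqr_ge0//.
rewrite normrM -(real_normK (num_real (f x))) -(real_normK (num_real (g x))).
have := sqr_ge0 (`|f x| - `|g x|); have := normr_ge0 (f x); have := normr_ge0 (g x); nra.
Qed.

Lemma integral_ee i j : (\int[mu]_x (e i x * e j x)%:E = ((i == j)%:R)%:E)%E.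
Proof.
rewrite -orth /L2inner /Rintegral fineK//; apply: (integrable_fin_num measurableT).
exact: integrable_prod.
Qed.

Lemma integral_dot_e N (c : nat -> R) i : (i < N)%N ->
  (\int[mu]_x (dot N c (e ^~ x) * e i x)%:E = (c i)%:E)%E.
Proof.
move=> iN.
rewrite (_ : (fun x => _) = (fun x => \sum_(j < N) (c j)%:E * (e j x * e i x)%:E)%E); last first.
  apply/funext => x; rewrite /dot mulr_suml -sumEFin; apply: eq_bigr => j _.
  by rewrite -EFinM mulrA.
rewrite integral_sum//; last first.
  by move=> j; apply: (integrableZl measurableT); exact: integrable_prod.
rewrite (bigD1 (Ordinal iN))//= big1 ?adde0.
  by rewrite (integralZl measurableT (integrable_prod (me i) (me i) (eL2 i) (eL2 i))) integral_ee eqxx mule1.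
move=> j ji; rewrite (integralZl measurableT (integrable_prod (me j) (me i) (eL2 j) (eL2 i))) integral_ee.
by rewrite (_ : (j == i :> nat) = false) ?mule0//; apply: contraNF ji => /eqP ji; apply/eqP/val_inj.
Qed.

Lemma measurable_dot_e N (c : nat -> R) : measurable_fun setT (fun x => dot N c (e ^~ x)).
Proof. by apply: measurable_sum => i; exact: measurable_funM. Qed.

Lemma integral_dot_sqr N (c : nat -> R) :
  (\int[mu]_x (dot N c (e ^~ x) ^+ 2)%:E = (dot N c c)%:E)%E.
Proof.
have iM M : (M <= N)%N -> mu.-integrable setT (fun x => (dot M c (e ^~ x) ^+ 2)%:E).
  elim: M => [_|M IH MN].
    rewrite (_ : (fun x => _) = (fun=> 0%E)); first exact: integrable0.
    by apply/funext => x; rewrite /dot big_ord0 expr0n.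
  have i1 := IH (ltnW MN).
  have i2 := integrable_prod (measurable_dot_e M c) (me M) i1 (eL2 M).
  have := integrableD measurableT
    (integrableD measurableT i1 (integrableZl measurableT (2 * c M) i2))
    (integrableZl measurableT (c M ^+ 2) (eL2 M)).
  apply: eq_integrable => // x _ /=; rewrite -!EFinM -!EFinD; congr EFin.
  by rewrite /dot big_ord_recr/=; ring.
have ie i : (i < N)%N -> mu.-integrable setT (fun x => (dot N c (e ^~ x) * e i x)%:E).
  by move=> iN; apply: integrable_prod => //; [exact: measurable_dot_e|exact: iM].
rewrite (_ : (fun x => _) = (fun x => \sum_(i < N) (c i)%:E * (dot N c (e ^~ x) * e i x)%:E)%E); last first.
  apply/funext => x; rewrite expr2 {2}/dot mulr_sumr -sumEFin; apply: eq_bigr => i _.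
  by rewrite -EFinM; congr EFin; ring.
rewrite integral_sum//; last by move=> i; apply: (integrableZl measurableT); exact: ie.
rewrite /dot -sumEFin; apply: eq_bigr => i _.
by rewrite (integralZl measurableT (ie i (ltn_ord i))) integral_dot_e// EFinM.
Qed.

Lemma integral_diag N (c : nat -> R) : (forall i, 0 <= c i) ->
  (\int[mu]_x (\sum_(i < N) c i * e i x ^+ 2)%:E = (\sum_(i < N) c i)%:E)%E.
Proof.
move=> c0.
rewrite (_ : (fun x => _) = (fun x => \sum_(i < N) (c i)%:E * (e i x ^+ 2)%:E)%E); last first.
  by apply/funext => x; rewrite -sumEFin; apply: eq_bigr => i _; rewrite -EFinM.
have me2 i : measurable_fun setT (fun x => (e i x ^+ 2)%:E).
  by apply/measurable_EFinP; exact: measurable_funX.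
rewrite ge0_integral_sum//.
- rewrite -sumEFin; apply: eq_bigr => i _.
  rewrite ge0_integralZl_EFin//; last by move=> x _; rewrite lee_fin sqr_ge0.
  rewrite [X in (_ * X)%E](_ : _ = 1%E) ?mule1//.
  have := integral_ee i i; rewrite eqxx => <-.
  by apply: eq_integral => x _; rewrite expr2.
- by move=> i; exact: measurable_funeM.
- by move=> i x _; rewrite -EFinM lee_fin mulr_ge0 ?sqr_ge0.
Qed.

Lemma integrable_dot_sqr N (c : nat -> R) :
  mu.-integrable setT (fun x => (dot N c (e ^~ x) ^+ 2)%:E).
Proof.
apply/integrableP; split.
  by apply/measurable_EFinP; apply: measurable_funX; exact: measurable_dot_e.
rewrite (eq_integral (fun x => (dot N c (e ^~ x) ^+ 2)%:E)); first by rewrite integral_dot_sqr ltry.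
by move=> x _; rewrite gee0_abs// lee_fin sqr_ge0.
Qed.

Context (f : T -> R) (mf : measurable_fun setT f) (A : nat -> R).
Hypothesis fA : (fun N : nat => (\int[mu]_x ((f x - dot N A (e ^~ x)) ^+ 2)%:E)%E) @ \oo --> 0%E.

(** One partial sum at squared distance below 1 from [f] suffices, partial sums being square
    integrable. *)
Lemma integrable_l2_limit : mu.-integrable setT (fun x => (f x ^+ 2)%:E).
Proof.
have mr N : measurable_fun setT (fun x => ((f x - dot N A (e ^~ x)) ^+ 2)%:E).
  by apply/measurable_EFinP; apply: measurable_funX; apply: measurable_funB => //; exact: measurable_dot_e.
have [N HN] : exists N, (\int[mu]_x ((f x - dot N A (e ^~ x)) ^+ 2)%:E < 1%:E)%E.
  have : nbhs 0%E [set y : \bar R | (y < 1%:E)%E] by apply: open_nbhs_nbhs; split; [exact: open_ereal_lt_ereal|rewrite /= lte_fin].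
  by move/fA => [N _ /(_ N (leqnn N))]; exists N.
have ir : mu.-integrable setT (fun x => ((f x - dot N A (e ^~ x)) ^+ 2)%:E).
  apply/integrableP; split => //; apply: le_lt_trans (lt_trans HN (ltry 1)).
  rewrite le_eqVlt; apply/orP; left; apply/eqP; apply: eq_integral => x _.
  by rewrite gee0_abs// lee_fin sqr_ge0.
have i3 := integrableD measurableT (integrableZl measurableT 2 ir) (integrableZl measurableT 2 (integrable_dot_sqr N A)).
apply: (le_integrable measurableT _ _ i3).
  by apply/measurable_EFinP; exact: measurable_funX.
move=> x _ /=; rewrite lee_fin ger0_norm ?sqr_ge0// ger0_norm; last first.
  by rewrite addr_ge0// mulr_ge0// sqr_ge0.
have := sqr_ge0 (f x - 2 * dot N A (e ^~ x)); nra.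
Qed.

Lemma l2_limit_coef i : L2inner mu f (e i) = A i.
Proof.
have fe := integrable_prod mf (me i) integrable_l2_limit (eL2 i).
have Hfe : (\int[mu]_x (f x * e i x)%:E = (L2inner mu f (e i))%:E)%E.
  by rewrite /L2inner /Rintegral fineK// (integrable_fin_num measurableT fe).
apply/eqP; rewrite -subr_eq0 -normr_le0; apply/ler_addgt0Pr => eps eps0; rewrite add0r.
have : nbhs 0%E [set y : \bar R | (y < (eps ^+ 2)%:E)%E].
  by apply: open_nbhs_nbhs; split; [exact: open_ereal_lt_ereal|rewrite /= lte_fin exprn_gt0].
(* [N] must also exceed [i], so that the partial sum contains [e i]. *)
move/fA => [N0 _ HN0]; pose N := maxn N0 i.+1.
have {HN0} : (\int[mu]_x ((f x - dot N A (e ^~ x)) ^+ 2)%:E < (eps ^+ 2)%:E)%E.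
  by apply: HN0; rewrite /= leq_maxl.
have iN : (i < N)%N by rewrite leq_maxr.
have mr : measurable_fun setT (fun x => f x - dot N A (e ^~ x)).
  by apply: measurable_funB => //; exact: measurable_dot_e.
move=> HN.
have ide := integrable_prod (measurable_dot_e N A) (me i) (integrable_dot_sqr N A) (eL2 i).
have D : (\int[mu]_x ((f x - dot N A (e ^~ x)) * e i x)%:E = (L2inner mu f (e i) - A i)%:E)%E.
  under eq_integral do rewrite mulrBl EFinB.
  by rewrite integralB_EFin// Hfe integral_dot_e// EFinB.
rewrite -lee_fin -abse_EFin -D.
apply: (le_trans (le_abse_integral _ _ _)) => //.
  by apply/measurable_EFinP; exact: measurable_funM.
(* In place of Cauchy-Schwarz, the weighted inequality [a * b <= a ^+ 2 / (2 * eps) + eps / 2 * b ^+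
   2]: each of the two terms contributes at most [eps / 2]. *)
have K : (\int[mu]_x ((2 * eps)^-1%:E * ((f x - dot N A (e ^~ x)) ^+ 2)%:E + (eps / 2)%:E * (e i x ^+ 2)%:E) <= eps%:E)%E.
  rewrite ge0_integralD//.
  - rewrite ge0_integralZl_EFin//.
    + rewrite ge0_integralZl_EFin//.
      * rewrite [X in (_ + _ * X)%E](_ : _ = 1%E); last first.
          by have := integral_ee i i; rewrite eqxx => <-; apply: eq_integral => x _; rewrite expr2.
        apply: (@le_trans _ _ ((2 * eps)^-1%:E * (eps ^+ 2)%:E + (eps / 2)%:E * 1)%E).
          by rewrite leeD2r// lee_wpmul2l ?ltW// lte_fin invr_gt0 mulr_gt0.
        rewrite mule1 -EFinM -EFinD lee_fin le_eqVlt; apply/orP; left; apply/eqP; field.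
        by rewrite gt_eqF.
      * by move=> x _; rewrite lee_fin sqr_ge0.
      * by apply/measurable_EFinP; exact: measurable_funX.
      * by rewrite divr_ge0// ltW.
    + by move=> x _; rewrite lee_fin sqr_ge0.
    + by apply/measurable_EFinP; exact: measurable_funX.
    + by rewrite invr_ge0 mulr_ge0// ltW.
  - by move=> x _; rewrite -EFinM lee_fin mulr_ge0 ?sqr_ge0// invr_ge0 mulr_ge0// ltW.
  - by apply: measurable_funeM; apply/measurable_EFinP; exact: measurable_funX.
  - by move=> x _; rewrite -EFinM lee_fin mulr_ge0 ?sqr_ge0// divr_ge0// ltW.
  - by apply: measurable_funeM; apply/measurable_EFinP; exact: measurable_funX.
apply: le_trans K; apply: ge0_le_integral => //.
- by apply: measurableT_comp => //; apply/measurable_EFinP; exact: measurable_funM.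
- by apply: emeasurable_funD; apply: measurable_funeM; apply/measurable_EFinP; exact: measurable_funX.
- move=> x _; rewrite abse_EFin -!EFinM -EFinD lee_fin normrM.
  rewrite -(real_normK (num_real (f x - _))) -(real_normK (num_real (e i x))).
  move: (`|_|) (`|_|) => b a.
  rewrite -(ler_pM2l (mulr_gt0 (ltr0n R 2) eps0)).
  rewrite [leRHS](_ : _ = a ^+ 2 + eps ^+ 2 * b ^+ 2); last by field; rewrite gt_eqF.
  have := sqr_ge0 (a - eps * b); nra.
Qed.

End orthonormal.

(** * The regularised function *)

Section powR_aux.
Context {R : realType}.
Implicit Types x a b : R.

Lemma powR_split x a b c : 0 < x -> a + b = c -> x `^ a * x `^ b = x `^ c.
Proof. by move=> x0 <-; rewrite powRD// (gt_eqF x0) implybT. Qed.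

Lemma powR_sqr x a : 0 < x -> (x `^ a) ^+ 2 = x `^ (2 * a).
Proof. by move=> x0; rewrite expr2 (@powR_split x a a (2 * a))//; ring. Qed.

(** In the variable [x = lam * nu] the left side is [x / (x + 1)], at most both [x] and 1; the
    smaller of these is at most [x] to any power in [0,1]. *)
Lemma ratio_le_powR (lam nu a : R) : 0 < lam -> 0 < nu -> 0 <= a <= 1 ->
  lam / (lam + nu^-1) <= lam `^ a * nu `^ a.
Proof.
move=> l0 n0 /andP[a0 a1]; rewrite -powRM ?(ltW l0) ?(ltW n0)//.
have x0 : 0 < lam * nu by exact: mulr_gt0.
have -> : lam / (lam + nu^-1) = (lam * nu) / (lam * nu + 1).
  by field; rewrite !gt_eqF//=; rewrite addr_gt0.
move: (lam * nu) x0 => x x0.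
have x1 : 0 < x + 1 by lra.
rewrite ler_pdivrMr//.
have [xl|xl] := leP x 1.
  have h : x <= x `^ a by rewrite ger1_powR// x0.
  by nra.
have : x `^ 0 <= x `^ a by rewrite ler_powR// ltW.
rewrite powRr0 => h; nra.
Qed.

Lemma exponent_le1 (s a : R) : 0 < s -> a <= 1 -> s <= a -> 0 <= 1 + (s - a) / 2 <= 1.
Proof. by move=> ? ? ?; apply/andP; split; lra. Qed.

Lemma exponent_le_tau (s a tau : R) : 0 <= a -> a <= s -> s <= 2 * tau ->
  0 <= (s - a) / 2 <= tau.
Proof. by move=> ? ? ?; apply/andP; split; lra. Qed.

Lemma sqr_decomp_le (w y z : R) : (w - (y - z)) ^+ 2 <= 2 * (w - y) ^+ 2 + 2 * z ^+ 2.
Proof. by have := sqr_ge0 (w - y - z); nra. Qed.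

Lemma residual_arith (E F p r M t x : R) : 0 <= E * p * r * M -> 0 <= F * p * r * M ->
  x <= E * p * r * M + t \/ x <= F * p * r * M /\ 0 <= t ->
  x <= M * (E + F) * r * p + t.
Proof. by move=> ? ? []; [lra|case; lra]. Qed.

Lemma zero_one_le1 : (0 : R) <= (1 : R) <= (1 : R).
Proof. apply/andP; split; lra. Qed.

End powR_aux.
Arguments zero_one_le1 : clear implicits.

Section regularized.
Context {R : realType} d (T : measurableType d) (mu : {measure set T -> \bar R}).
Context (lam : nat -> R) (e : nat -> T -> R).
Hypothesis lam0 : forall i, 0 < lam i.
Hypothesis me : forall i, measurable_fun setT (e i).
Hypothesis eL2 : forall i, mu.-integrable setT (fun x => ((e i x) ^+ 2)%:E).
Hypothesis orth : forall i j, L2inner mu (e i) (e j) = (i == j)%:R.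
Context (phi : R -> R -> R) (Ef Ft tau kap nu : R).
Hypothesis nu0 : 0 < nu.
Hypothesis lamk : forall i, lam i <= kap.
Hypothesis phi0 : forall z, 0 <= z <= kap -> 0 <= phi nu z.
Hypothesis phiE : forall a z, 0 <= a <= 1 -> 0 <= z <= kap ->
  z `^ a * phi nu z <= Ef * nu `^ (1 - a).
Hypothesis phiF : forall a z, 0 <= a <= tau -> 0 <= z <= kap ->
  `|1 - z * phi nu z| * z `^ a <= Ft * nu `^ (- a).
Context (f : T -> R) (mf : measurable_fun setT f) (a : nat -> R) (s Rad alpha M : R).
Hypothesis tau1 : 1 <= tau.
Hypothesis s0 : 0 < s.
Hypothesis stau : s <= 2 * tau.
Hypothesis Rad0 : 0 <= Rad.
Hypothesis aRad : forall N, dot N a a <= Rad ^+ 2.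
Hypothesis al0 : 0 < alpha.
Hypothesis al1 : alpha <= 1.
Hypothesis M0 : 0 <= M.

Let A i := a i * lam i `^ (s / 2).
Hypothesis fA : (fun N : nat => (\int[mu]_x ((f x - dot N A (e ^~ x)) ^+ 2)%:E)%E) @ \oo --> 0%E.

Let good x := forall N, \sum_(i < N) lam i `^ alpha * e i x ^+ 2 <= M ^+ 2.
Hypothesis goodae : {ae mu, forall x, good x}.

(** The multiplier taking the coefficients of [f] to those of [f_nu]; the residual has multiplier
    [1 - b i], which the qualification of the filter controls. *)
Let b i := lam i * phi nu (lam i).
Let lamI i : 0 <= lam i <= kap. Proof. by rewrite ltW//=. Qed.
Let f_nu := fnu mu lam e phi nu f.

(** The sign is read off the filter bound at exponent 1, where the power of [nu] is 1; [Ft_ge0] uses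
    exponent 0 likewise. *)
Lemma Ef_ge0 : 0 <= Ef.
Proof.
have := phiE (zero_one_le1 R) (lamI 0); rewrite subrr powRr0 mulr1 powRr1 ?(ltW (lam0 0))//.
apply: le_trans; by rewrite mulr_ge0 ?phi0// ltW.
Qed.

Lemma Ft_ge0 : 0 <= Ft.
Proof.
have t0 : (0 : R) <= 0 <= tau by rewrite lexx (le_trans ler01).
have := phiF t0 (lamI 0); rewrite oppr0 !powRr0 !mulr1.
by apply: le_trans.
Qed.

Lemma f_nuE x : f_nu x = limn (fun N => dot N (fun i => b i * A i) (e ^~ x)).
Proof.
rewrite /f_nu /fnu /rsum; congr (limn _); apply/funext => N; apply: eq_bigr => i _.
rewrite /fnu_coord (l2_limit_coef me eL2 orth mf fA) /b.
have q : Num.sqrt (lam i) ^+ 2 = lam i by rewrite sqr_sqrtr// ltW.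
by rewrite -[X in X * phi _ _]q; ring.
Qed.

Lemma measurable_f_nu : measurable_fun setT f_nu.
Proof.
rewrite (_ : f_nu = (fun x => limn (fun N => dot N (fun i => b i * A i) (e ^~ x)))).
  apply: (measurable_limn (u := fun N x => dot N (fun i => b i * A i) (e ^~ x))) => N.
  exact: measurable_dot_e.
by apply/funext => x; exact: f_nuE.
Qed.

(* Cauchy-Schwarz, splitting lam^(s/2) as lam^((s-alpha)/2) * lam^(alpha/2). *)
Lemma good_series (c : nat -> R) (K : R) x : 0 <= K ->
  (forall i, `|c i| * lam i `^ ((s - alpha) / 2) <= K) -> good x ->
  cvgn (fun N => dot N (fun i => c i * A i) (e ^~ x)) /\
  `|limn (fun N => dot N (fun i => c i * A i) (e ^~ x))| <= K * Rad * M.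
Proof.
move=> K0 cK gx.
pose u i := c i * a i * lam i `^ ((s - alpha) / 2).
pose v i := lam i `^ (alpha / 2) * e i x.
have uv : (fun N => dot N (fun i => c i * A i) (e ^~ x)) = (fun N => dot N u v).
  apply/funext => N; apply: eq_bigr => i _; rewrite /A /u /v.
  rewrite -(@powR_split _ (lam i) ((s - alpha) / 2) (alpha / 2))//; first by ring.
  by field.
rewrite uv; apply: l2_series_cvg => //; first exact: mulr_ge0.
  move=> N; apply: (@le_trans _ _ (\sum_(i < N) K ^+ 2 * (a i * a i))).
    apply: ler_sum => i _; rewrite /u.
    rewrite [leLHS](_ : _ = (`|c i| * lam i `^ ((s - alpha) / 2)) ^+ 2 * (a i * a i)); last first.
      by rewrite exprMn real_normK ?num_real//; ring.
    apply: ler_wpM2r; first by rewrite -expr2 sqr_ge0.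
    by apply: lerXn2r; rewrite ?nnegrE ?mulr_ge0 ?powR_ge0//; exact: cK.
  by rewrite -mulr_sumr exprMn ler_wpM2l ?sqr_ge0//; exact: aRad.
move=> N; apply: le_trans (gx N); apply: ler_sum => i _.
rewrite /v [leLHS](_ : _ = (lam i `^ (alpha / 2)) ^+ 2 * e i x ^+ 2); last by ring.
by rewrite powR_sqr// (_ : 2 * (alpha / 2) = alpha)//; field.
Qed.

Let onemb_bound i q : 0 <= q <= tau -> `|1 - b i| * lam i `^ q <= Ft * nu `^ (- q).
Proof. by move=> hq; exact: phiF. Qed.

(** Partial sums with multiplier [c]: the choices [1], [b] and [1 - b] give those of [f], of [f_nu]
    and of the residual. *)
Let D c N x := dot N (fun i => c i * A i) (e ^~ x).

Let D1 N x : D (fun=> 1) N x = dot N A (e ^~ x).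
Proof. by apply: eq_bigr => i _; rewrite mul1r. Qed.

Let DB N x : D b N x = D (fun=> 1) N x - D (fun i => 1 - b i) N x.
Proof. by rewrite /D /dot -sumrB; apply: eq_bigr => i _; ring. Qed.

Let case_le x : s <= alpha -> good x ->
  D b ^~ x @ \oo --> f_nu x /\ `|f_nu x| <= Ef * nu `^ ((alpha - s) / 2) * Rad * M.
Proof.
move=> sa gx; rewrite f_nuE.
have h1 : 0 <= Ef * nu `^ ((alpha - s) / 2) by rewrite mulr_ge0 ?powR_ge0// Ef_ge0.
suff h2 i : `|b i| * lam i `^ ((s - alpha) / 2) <= Ef * nu `^ ((alpha - s) / 2).
  by have [] := good_series h1 h2 gx.
rewrite ger0_norm; last by rewrite mulr_ge0 ?phi0// ltW.
(* The factor [lam i] in [b i] raises the negative exponent [(s - alpha) / 2] by one, into the range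
   of the first filter bound. *)
have := phiE (exponent_le1 s0 al1 sa) (lamI i).
have -> : 1 - (1 + (s - alpha) / 2) = (alpha - s) / 2 by field.
apply: le_trans.
rewrite le_eqVlt; apply/orP; left; apply/eqP; rewrite /b.
rewrite -(@powR_split _ (lam i) 1 ((s - alpha) / 2) (1 + (s - alpha) / 2))// powRr1 ?(ltW (lam0 i))//; ring.
Qed.

(** For [alpha < s] the exponent is positive, so [good_series] applies to the multiplier 1, that is,
    to the series of [f] itself. *)
Let one_bound i : alpha < s -> `|1 : R| * lam i `^ ((s - alpha) / 2) <= kap `^ ((s - alpha) / 2).
Proof.
move=> as_; rewrite normr1 mul1r; apply: ge0_ler_powR => //.
- by rewrite divr_ge0// subr_ge0 ltW.
- by rewrite nnegrE ltW.
- by rewrite nnegrE ltW// (lt_le_trans (lam0 0)).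
Qed.

(** The partial sums tend to [f] in L^2 and to [g] pointwise; Fatou's lemma equates the two limits
    without extracting a subsequence. *)
Let f_eq_lim : alpha < s ->
  {ae mu, forall x, f x = limn (fun N => D (fun=> 1) N x)}.
Proof.
move=> as_; pose g x := limn (fun N => D (fun=> 1) N x).
have mD N : measurable_fun setT (fun x => D (fun=> 1) N x) by exact: measurable_dot_e.
have mg : measurable_fun setT g by exact: (measurable_limn mD).
have H : (\int[mu]_x ((f x - g x) ^+ 2)%:E <= 0)%E.
  apply: (@ae_fatou _ _ _ _ (fun N x => (f x - D (fun=> 1) N x) ^+ 2) _
    (fun N : nat => (\int[mu]_x ((f x - dot N A (e ^~ x)) ^+ 2)%:E)%E)) => //.
  - by move=> N; apply: measurable_funX; exact: measurable_funB.
  - by apply: measurable_funX; exact: measurable_funB.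
  - by move=> N x; exact: sqr_ge0.
  - by move=> x; exact: sqr_ge0.
  - apply: filterS goodae => x gx.
    have [cv _] := good_series (c := fun=> 1) (powR_ge0 kap ((s - alpha) / 2)) (fun i => one_bound i as_) gx.
    have c1 : (fun N => f x - D (fun=> 1) N x) @ \oo --> f x - g x.
      exact: (cvgB (cvg_cst (f x)) cv).
    by rewrite !expr2; under eq_fun do rewrite expr2; exact: cvgM.
  - move=> N; rewrite le_eqVlt; apply/orP; left; apply/eqP; apply: eq_integral => x _.
    by rewrite D1.
have m2 : measurable_fun setT (fun x => ((f x - g x) ^+ 2)%:E).
  by apply/measurable_EFinP; apply: measurable_funX; exact: measurable_funB.
have : (\int[mu]_x `|((f x - g x) ^+ 2)%:E| = 0)%E.
  apply/eqP; rewrite eq_le integral_ge0 ?andbT//.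
  apply: le_trans H; rewrite le_eqVlt; apply/orP; left; apply/eqP; apply: eq_integral => x _.
  by rewrite gee0_abs// lee_fin sqr_ge0.
move/(ae_eq_integral_abs mu measurableT m2); apply: filterS => x /(_ I)/= [/eqP].
by rewrite sqrf_eq0 subr_eq0 => /eqP.
Qed.

Let case_gt x : alpha < s -> good x -> f x = limn (fun N => D (fun=> 1) N x) ->
  D b ^~ x @ \oo --> f_nu x /\ `|f x - f_nu x| <= Ft * nu `^ ((alpha - s) / 2) * Rad * M.
Proof.
move=> as_ gx fx.
have [cv1 _] := good_series (c := fun=> 1) (powR_ge0 kap ((s - alpha) / 2)) (fun i => one_bound i as_) gx.
have h1 : 0 <= Ft * nu `^ ((alpha - s) / 2) by rewrite mulr_ge0 ?powR_ge0// Ft_ge0.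
have h2 i : `|1 - b i| * lam i `^ ((s - alpha) / 2) <= Ft * nu `^ ((alpha - s) / 2).
  have := onemb_bound i (exponent_le_tau (ltW al0) (ltW as_) stau).
  by rewrite (_ : - ((s - alpha) / 2) = (alpha - s) / 2)//; field.
have [cv2 bd2] := good_series h1 h2 gx.
have cb : D b ^~ x @ \oo --> f x - limn (D (fun i => 1 - b i) ^~ x).
  rewrite (_ : D b ^~ x = fun N => D (fun=> 1) N x - D (fun i => 1 - b i) N x).
    by rewrite fx; exact: (cvgB cv1 cv2).
  by apply/funext => N; exact: DB.
have fnE : f_nu x = f x - limn (D (fun i => 1 - b i) ^~ x).
  by rewrite f_nuE; exact: cvg_lim cb.
by rewrite fnE; split => //; rewrite opprB addrC subrK.
Qed.

Lemma ae_cvg_f_nu : {ae mu, forall x, D b ^~ x @ \oo --> f_nu x}.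
Proof.
have [sa|as_] := leP s alpha.
  by apply: filterS goodae => x gx; have [] := case_le sa gx.
by apply: filterS2 goodae (f_eq_lim as_) => x gx fx; have [] := case_gt as_ gx fx.
Qed.

Lemma ae_residual_le t : 0 <= t -> {ae mu, forall x, `|f x| <= t ->
  `|f x - f_nu x| <= M * (Ef + Ft) * Rad * nu `^ ((alpha - s) / 2) + t}.
Proof.
move=> t0.
have p0 : 0 <= nu `^ ((alpha - s) / 2) by exact: powR_ge0.
have hE : 0 <= Ef * nu `^ ((alpha - s) / 2) * Rad * M by rewrite !mulr_ge0// Ef_ge0.
have hF : 0 <= Ft * nu `^ ((alpha - s) / 2) * Rad * M by rewrite !mulr_ge0// Ft_ge0.
have [sa|as_] := leP s alpha.
  apply: filterS goodae => x gx ft; have [_ h] := case_le sa gx.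
  apply: (residual_arith hE hF) => //; left.
  by apply: (le_trans (ler_normB _ _)); rewrite addrC lerD.
apply: filterS2 goodae (f_eq_lim as_) => x gx fx _; have [_ h] := case_gt as_ gx fx.
by apply: (residual_arith hE hF) => //; right.
Qed.

(** [f - D b N] splits into the tail of [f], which vanishes in L^2, and a finite sum with multiplier
    [1 - b], bounded by orthonormality and the qualification at exponent [s / 2]. Squaring this
    split costs the factor 2. *)
Lemma integral_residual_le :
  (\int[mu]_x ((f x - f_nu x) ^+ 2)%:E <= (2 * (Ft * Rad * nu `^ (- (s / 2))) ^+ 2)%:E)%E.
Proof.
have mD c N : measurable_fun setT (fun x => D c N x) by exact: measurable_dot_e.
set r := fun N : nat => (\int[mu]_x ((f x - dot N A (e ^~ x)) ^+ 2)%:E)%E.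
set k := 2 * (Ft * Rad * nu `^ (- (s / 2))) ^+ 2.
apply: (@ae_fatou _ _ _ _ (fun N x => (f x - D b N x) ^+ 2) _ (fun N => 2%:E * r N + k%:E)%E).
- by move=> N; apply: measurable_funX; exact: measurable_funB.
- by apply: measurable_funX; apply: measurable_funB => //; exact: measurable_f_nu.
- by move=> N x; exact: sqr_ge0.
- by move=> x; exact: sqr_ge0.
- apply: filterS ae_cvg_f_nu => x cx.
  have c1 : (fun N => f x - D b N x) @ \oo --> f x - f_nu x.
    exact: (cvgB (cvg_cst (f x)) cx).
  by rewrite !expr2; under eq_fun do rewrite expr2; exact: cvgM.
- move=> N.
  have mr : measurable_fun setT (fun x => ((f x - dot N A (e ^~ x)) ^+ 2)%:E).
    by apply/measurable_EFinP; apply: measurable_funX; apply: measurable_funB => //; exact: measurable_dot_e.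
  have m1 : measurable_fun setT (fun x => (D (fun i => 1 - b i) N x ^+ 2)%:E).
    by apply/measurable_EFinP; exact: measurable_funX.
  apply: (@le_trans _ _ (\int[mu]_x (2%:E * ((f x - dot N A (e ^~ x)) ^+ 2)%:E
     + 2%:E * (D (fun i => 1 - b i) N x ^+ 2)%:E))%E).
    apply: ge0_le_integral => //.
    + by move=> x _; rewrite lee_fin sqr_ge0.
    + by apply/measurable_EFinP; apply: measurable_funX; exact: measurable_funB.
    + by apply: emeasurable_funD; exact: measurable_funeM.
    + move=> x _; rewrite -!EFinM -EFinD lee_fin DB -D1.
      move: (D (fun=> 1) N x) (D _ N x) (f x) => y z w.
      exact: sqr_decomp_le.
  rewrite ge0_integralD//.
  + rewrite ge0_integralZl_EFin//; last by move=> x _; rewrite lee_fin sqr_ge0.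
    rewrite ge0_integralZl_EFin//; last by move=> x _; rewrite lee_fin sqr_ge0.
    rewrite leeD2l// (integral_dot_sqr me eL2 orth) -EFinM lee_fin ler_wpM2l//.
    apply: (@le_trans _ _ (\sum_(i < N) (Ft * nu `^ (- (s / 2))) ^+ 2 * (a i * a i))).
      apply: ler_sum => i _.
      rewrite /A [leLHS](_ : _ = (`|1 - b i| * lam i `^ (s / 2)) ^+ 2 * (a i * a i)); last first.
        by rewrite exprMn real_normK ?num_real//; ring.
      apply: ler_wpM2r; first by rewrite -expr2 sqr_ge0.
      apply: lerXn2r; rewrite ?nnegrE ?mulr_ge0 ?powR_ge0 ?Ft_ge0//.
      have := @exponent_le_tau _ s 0 tau (lexx (0 : R)) (ltW s0) stau.
      by rewrite subr0; exact: onemb_bound.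
    rewrite -mulr_sumr [leRHS](_ : _ = (Ft * nu `^ (- (s / 2))) ^+ 2 * Rad ^+ 2); last by ring.
    by rewrite ler_wpM2l ?sqr_ge0//; exact: aRad.
  + by move=> x _; rewrite -EFinM lee_fin mulr_ge0 ?sqr_ge0.
  + exact: measurable_funeM.
  + by move=> x _; rewrite -EFinM lee_fin mulr_ge0 ?sqr_ge0.
  + exact: measurable_funeM.
- rewrite -[X in _ --> X]add0e -[X in _ --> (X + _)%E](mule0 2%:E).
  apply: cvgeD; [by []| |exact: cvg_cst].
  by apply: cvgeZl.
Qed.

Lemma good_feature x N : good x ->
  \sum_(i < N) lam i * e i x ^+ 2 / (lam i + nu^-1) <= M ^+ 2 * nu `^ alpha.
Proof.
move=> gx; apply: (@le_trans _ _ (\sum_(i < N) (lam i `^ alpha * e i x ^+ 2) * nu `^ alpha)).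
  apply: ler_sum => i _.
  rewrite mulrAC [leRHS](_ : _ = (lam i `^ alpha * nu `^ alpha) * e i x ^+ 2); last by ring.
  by rewrite ler_wpM2r ?sqr_ge0// ratio_le_powR// ltW.
by rewrite -mulr_suml ler_wpM2r ?powR_ge0.
Qed.

Lemma integral_feature N :
  (\int[mu]_x (\sum_(i < N) lam i * e i x ^+ 2 / (lam i + nu^-1))%:E =
   (\sum_(i < N) lam i / (lam i + nu^-1))%:E)%E.
Proof.
have p0 i : 0 <= lam i / (lam i + nu^-1).
  by rewrite divr_ge0 ?addr_ge0 ?invr_ge0// ltW.
rewrite -(integral_diag me eL2 orth N p0); apply: eq_integral => x _; congr EFin.
by apply: eq_bigr => i _; rewrite mulrAC.
Qed.

End regularized.

(** * Moments of xi *)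

Section moment_arith.
Context {R : realType}.

Lemma exprD_le (u v : R) m : 0 <= u -> 0 <= v ->
  (u + v) ^+ m.+2 <= 2 * 2 ^+ m * (u ^+ m.+2 + v ^+ m.+2).
Proof.
move=> u0 v0; have := @exprn_convex R 2^-1 u v m.+2 _ u0 v0.
rewrite (_ : 1 - 2^-1 = 2^-1 :> R); last by field.
rewrite -!mulrDr exprMn => /(_ _) h.
have {}h : 2^-1 ^+ m.+2 * (u + v) ^+ m.+2 <= 2^-1 * (u ^+ m.+2 + v ^+ m.+2).
  by apply: h; apply/andP; split; lra.
have p0 : 0 < 2 ^+ m.+2 :> R by exact: exprn_gt0.
have := ler_wpM2l (ltW p0) h.
rewrite mulrA -exprMn divff// expr1n mul1r => {}h; apply: (le_trans h).
by rewrite le_eqVlt; apply/orP; left; apply/eqP; rewrite !exprS; field.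
Qed.

(** Here [eps] is the noise, [del] the residual and [h] the feature norm. Two factors [h] are kept
    in the noise term and two factors [del] in the residual term, to be integrated; the other
    factors [h] and [del] are replaced by their bounds. *)
Lemma pointwise_moment_le (eps del h h2 H D w : R) m :
  0 <= eps -> 0 <= del -> 0 <= h -> 0 <= w -> h ^+ 2 = h2 -> 0 <= H -> h2 <= H ^+ 2 ->
  del <= D -> w <= (eps + del) * h ->
  w ^+ m.+2 <= 2 * 2 ^+ m * H ^+ m * (h2 * eps ^+ m.+2) +
    2 * 2 ^+ m * H ^+ m * D ^+ m * H ^+ 2 * del ^+ 2.
Proof.
move=> e0 d0 h0 w0 hh H0 hH dD wle.
have hleH : h <= H by rewrite -(@ler_pXn2r _ 2)// ?nnegrE// hh.
have D0 : 0 <= D := le_trans d0 dD.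
have c0 : 0 <= 2 * 2 ^+ m :> R by rewrite mulr_ge0// exprn_ge0.
apply: (@le_trans _ _ (((eps + del) * h) ^+ m.+2)).
  by apply: lerXn2r => //; rewrite nnegrE ?mulr_ge0 ?addr_ge0.
rewrite exprMn.
apply: (@le_trans _ _ (2 * 2 ^+ m * (eps ^+ m.+2 + del ^+ m.+2) * h ^+ m.+2)).
  by rewrite ler_wpM2r ?exprn_ge0// exprD_le.
have hm : h ^+ m.+2 = h ^+ m * h2 by rewrite -hh -exprD addn2.
have dm : del ^+ m.+2 = del ^+ m * del ^+ 2 by rewrite -exprD addn2.
have hmH : h ^+ m <= H ^+ m by apply: lerXn2r.
have dmD : del ^+ m <= D ^+ m by apply: lerXn2r.
have h20 : 0 <= h2 by rewrite -hh sqr_ge0.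
have hm0 : 0 <= h ^+ m by exact: exprn_ge0.
have dm0 : 0 <= del ^+ m by exact: exprn_ge0.
have ep0 : 0 <= eps ^+ m.+2 by exact: exprn_ge0.
rewrite mulrDr mulrDl; apply: lerD.
  rewrite hm [leLHS](_ : _ = 2 * 2 ^+ m * (h2 * eps ^+ m.+2) * h ^+ m); last by ring.
  rewrite [leRHS](_ : _ = 2 * 2 ^+ m * (h2 * eps ^+ m.+2) * H ^+ m); last by ring.
  by rewrite ler_wpM2l// mulr_ge0// mulr_ge0.
rewrite hm dm [leLHS](_ : _ = 2 * 2 ^+ m * del ^+ 2 * (h ^+ m * (del ^+ m * h2))); last by ring.
rewrite [leRHS](_ : _ = 2 * 2 ^+ m * del ^+ 2 * (H ^+ m * (D ^+ m * H ^+ 2))); last by ring.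
rewrite ler_wpM2l ?mulr_ge0 ?exprn_ge0//.
by rewrite ler_pM ?mulr_ge0// ler_pM.
Qed.

(** The powers of [L] and [D] are both dominated by those of [D + L], and the factorial factor,
    being at least 1, may be inserted in the residual term. *)
Lemma moment_constant_le (sig L Nn V H D S : R) m : 0 <= L -> 0 <= Nn -> 0 <= V -> 0 <= H -> 0 <= D ->
  2 * sig ^+ 2 * Nn + 2 * H ^+ 2 * V <= S ^+ 2 ->
  2 * 2 ^+ m * H ^+ m * ((m.+2)`!%:R / 2 * sig ^+ 2 * L ^+ m * Nn) +
    2 * 2 ^+ m * H ^+ m * D ^+ m * H ^+ 2 * V <=
  (m.+2)`!%:R / 2 * S ^+ 2 * (2 * H * (D + L)) ^+ m.
Proof.
move=> L0 N0 V0 H0 D0 hS.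
have f1 : 1 <= (m.+2)`!%:R / 2 :> R.
  rewrite ler_pdivlMr// mul1r (ler_nat _ 2) factS (leq_trans _ (leq_pmulr _ (fact_gt0 _)))//.
move: ((m.+2)`!%:R / 2) f1 => F F1.
have LD : L ^+ m <= (D + L) ^+ m by apply: lerXn2r; rewrite ?nnegrE ?addr_ge0// lerDr.
have DD : D ^+ m <= (D + L) ^+ m by apply: lerXn2r; rewrite ?nnegrE ?addr_ge0// lerDl.
rewrite !exprMn.
have K0 : 0 <= 2 ^+ m * H ^+ m by rewrite mulr_ge0// exprn_ge0.
have Dm : 0 <= D ^+ m by exact: exprn_ge0.
have Lm : 0 <= L ^+ m by exact: exprn_ge0.
have s0 := sqr_ge0 sig; have H20 := sqr_ge0 H.
rewrite [leLHS](_ : _ = 2 ^+ m * H ^+ m * (F * (2 * sig ^+ 2 * Nn) * L ^+ m + 2 * H ^+ 2 * V * D ^+ m)); last by ring.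
rewrite [leRHS](_ : _ = 2 ^+ m * H ^+ m * (F * S ^+ 2 * (D + L) ^+ m)); last by ring.
apply: ler_wpM2l => //.
have A0 : 0 <= 2 * sig ^+ 2 * Nn by apply: mulr_ge0 => //; apply: mulr_ge0.
have B0 : 0 <= 2 * H ^+ 2 * V by apply: mulr_ge0 => //; apply: mulr_ge0.
move: (2 * sig ^+ 2 * Nn) (2 * H ^+ 2 * V) A0 B0 hS => A B A0 B0 hS.
have F0 : 0 <= F by lra.
have DL0 : 0 <= (D + L) ^+ m by rewrite exprn_ge0// addr_ge0.
apply: (@le_trans _ _ (F * A * (D + L) ^+ m + F * B * (D + L) ^+ m)).
  apply: lerD; first by rewrite ler_wpM2l// mulr_ge0.
  apply: ler_pM => //; by rewrite -[leLHS]mul1r ler_wpM2r.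
by rewrite -mulrDl -mulrDr ler_wpM2r// ler_wpM2l.
Qed.

End moment_arith.

Section moment.
Context {R : realType} d (T : measurableType d).
Context (rho : probability (T * R)%type R) (mu : {measure set T -> \bar R}).
Hypothesis hmu : forall A, measurable A -> mu A = rho (A `*` setT).

Lemma ae_marginal (Q : T -> Prop) : {ae mu, forall x, Q x} -> {ae rho, forall z, Q z.1}.
Proof.
move=> [N [mN N0 NQ]]; exists (N `*` setT); split.
- exact: measurableX.
- by rewrite -hmu.
- by move=> z /= hz; split => //; exact: NQ.
Qed.

Context (f fn h2 : T -> R) (W : T * R -> R) (sig L Nn V H D S : R) (t : R).
Hypothesis mf : measurable_fun setT f.
Hypothesis mfn : measurable_fun setT fn.
Hypothesis mh2 : measurable_fun setT h2.
Hypothesis mW : measurable_fun setT W.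
Hypothesis h20 : forall x, 0 <= h2 x.
Hypothesis h2H : {ae mu, forall x, h2 x <= H ^+ 2}.
Hypothesis ih2 : (\int[mu]_x (h2 x)%:E <= Nn%:E)%E.
Hypothesis res : {ae mu, forall x, `|f x| <= t -> `|f x - fn x| <= D}.
Hypothesis ires : (\int[mu]_x ((f x - fn x) ^+ 2)%:E <= V%:E)%E.
Hypothesis W0 : forall z, 0 <= W z.
Hypothesis Wout : forall z, t < `|f z.1| -> W z = 0.
Hypothesis Wle : forall z, W z <= `|z.2 - fn z.1| * Num.sqrt (h2 z.1).
Hypothesis L0 : 0 <= L.
Hypothesis H0 : 0 <= H.
Hypothesis D0 : 0 <= D.
Hypothesis Nn0 : 0 <= Nn.
Hypothesis V0 : 0 <= V.
Hypothesis hnoise : forall m : nat, (2 <= m)%N -> forall A, measurable A ->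
  (\int[rho]_(z in A `*` setT) (`|z.2 - f z.1| ^+ m)%:E
       <= ((m`!)%:R / 2 * sig ^+ 2 * L ^+ (m - 2))%:E * mu A)%E.
Hypothesis hS : 2 * sig ^+ 2 * Nn + 2 * H ^+ 2 * V <= S ^+ 2.

Lemma moment_le m : (2 <= m)%N ->
  (\int[rho]_z (W z ^+ m)%:E <= (m`!%:R / 2 * S ^+ 2 * (2 * H * (D + L)) ^+ (m - 2))%:E)%E.
Proof.
case: m => [|[|m]]// _; have e2 : (m.+2 - 2 = m)%N by rewrite -addn2 addnK.
rewrite e2.
pose c := 2 * 2 ^+ m * H ^+ m.
have c0 : 0 <= c by rewrite !mulr_ge0 ?exprn_ge0.
pose c' := 2 * 2 ^+ m * H ^+ m * D ^+ m * H ^+ 2.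
have c'0 : 0 <= c' by rewrite !mulr_ge0 ?exprn_ge0.
have meps : measurable_fun [set: (T * R)%type] (fun z => `|z.2 - f z.1| ^+ m.+2).
  apply: measurable_funX; apply: measurableT_comp => //; apply: measurable_funB.
    exact: measurable_snd.
  exact: (measurableT_comp mf measurable_fst).
have mr : measurable_fun setT (fun x => (f x - fn x) ^+ 2).
  by apply: measurable_funX; exact: measurable_funB.
have mhe : measurable_fun [set: (T * R)%type] (fun z => ((h2 z.1)%:E * (`|z.2 - f z.1| ^+ m.+2)%:E)%E).
  apply: emeasurable_funM; apply/measurable_EFinP => //.
  exact: (measurableT_comp mh2 measurable_fst).
have mr1 : measurable_fun [set: (T * R)%type] (fun z => ((f z.1 - fn z.1) ^+ 2)%:E).
  by apply/measurable_EFinP; exact: (measurableT_comp mr measurable_fst).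
have he0 (z : T * R) : (0 <= (h2 z.1)%:E * (`|z.2 - f z.1| ^+ m.+2)%:E)%E.
  by rewrite -EFinM lee_fin mulr_ge0// exprn_ge0.
have r0 (z : T * R) : (0 <= ((f z.1 - fn z.1) ^+ 2)%:E)%E by rewrite lee_fin sqr_ge0.
apply: (@le_trans _ _ (\int[rho]_z (c%:E * ((h2 z.1)%:E * (`|z.2 - f z.1| ^+ m.+2)%:E)
   + c'%:E * ((f z.1 - fn z.1) ^+ 2)%:E))%E).
  apply: ae_ge0_le_integral => //.
  - by move=> z _; rewrite lee_fin exprn_ge0.
  - by apply/measurable_EFinP; exact: measurable_funX.
  - by move=> z _; rewrite adde_ge0// mule_ge0.
  - by apply: emeasurable_funD; exact: measurable_funeM.
  - apply: filterS2 (ae_marginal h2H) (ae_marginal res) => z hH rD _.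
    rewrite -!EFinM -EFinD lee_fin.
    (* Where [f] exceeds [t] there is no bound on the residual, but [W] vanishes. *)
    have [tf|ft] := ltP t `|f z.1|.
      rewrite Wout// expr0n/=; apply: addr_ge0.
        by apply: mulr_ge0 => //; apply: mulr_ge0 => //; exact: exprn_ge0.
      by apply: mulr_ge0 => //; exact: sqr_ge0.
    have := @pointwise_moment_le R `|z.2 - f z.1| `|f z.1 - fn z.1| (Num.sqrt (h2 z.1))
      (h2 z.1) H D (W z) m.
    rewrite real_normK ?num_real// sqr_sqrtr// sqrtr_ge0 !normr_ge0 W0.
    apply => //; first exact: rD.
    apply: (le_trans (Wle z)); rewrite ler_wpM2r ?sqrtr_ge0//.
    by rewrite (le_trans _ (ler_normD _ _))// addrA subrK.
rewrite ge0_integralD//; last 4 first.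
- by move=> z _; rewrite mule_ge0.
- exact: measurable_funeM.
- by move=> z _; rewrite mule_ge0.
- exact: measurable_funeM.
rewrite (ge0_integralZl_EFin rho measurableT (fun z _ => he0 z) mhe c0).
rewrite (ge0_integralZl_EFin rho measurableT (fun z _ => r0 z) mr1 c'0).
have K0 : 0 <= (m.+2)`!%:R / 2 * sig ^+ 2 * L ^+ m.
  apply: mulr_ge0; last exact: exprn_ge0.
  by apply: mulr_ge0; [rewrite divr_ge0|exact: sqr_ge0].
have mfst : measurable_fun [set: (T * R)%type] fst by exact: measurable_fst.
have eps0 (z : T * R) : 0 <= `|z.2 - f z.1| ^+ m.+2 by exact: exprn_ge0.
have I1 : (\int[rho]_z ((h2 z.1)%:E * (`|z.2 - f z.1| ^+ m.+2)%:E) <=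
    ((m.+2)`!%:R / 2 * sig ^+ 2 * L ^+ m)%:E * Nn%:E)%E.
  apply: (@le_trans _ _ (((m.+2)`!%:R / 2 * sig ^+ 2 * L ^+ m)%:E * \int[mu]_x (h2 x)%:E)%E).
    apply: (weighted_integral_le mfst meps eps0 K0) => // A mA.
    have -> : fst @^-1` A = A `*` [set: R].
      by apply/seteqP; split => z /=; [move=> ?; split|case].
    by have := hnoise (m := m.+2) isT mA; rewrite e2.
  by rewrite lee_wpmul2l.
have I2 : (\int[rho]_z ((f z.1 - fn z.1) ^+ 2)%:E <= V%:E)%E.
  have mrE : measurable_fun setT (fun x => ((f x - fn x) ^+ 2)%:E) by exact/measurable_EFinP.
  have r0x x : (0 <= ((f x - fn x) ^+ 2)%:E)%E by rewrite lee_fin sqr_ge0.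
  by rewrite (integral_marginal hmu mrE r0x).
apply: (le_trans (leeD (lee_wpmul2l _ I1) (lee_wpmul2l _ I2))) => //.
rewrite -!EFinM -EFinD lee_fin; exact: moment_constant_le.
Qed.

End moment.

(** * The embedding constant and the effective dimension *)

Section embedding.
Context {R : realType} d (T : measurableType d) (mu : {measure set T -> \bar R}).
Context (lam : nat -> R) (e : nat -> T -> R).
Hypothesis lam0 : forall i, 0 < lam i.
Hypothesis lamS : forall i, lam i.+1 <= lam i.

Let term a x i : \bar R := (lam i `^ a * e i x ^+ 2)%:E.

Lemma Malpha_ge0 a : (0 <= Malpha mu lam e a)%E.
Proof. by apply: le_ereal_inf_tmp => _ [A [A0 _] <-]; rewrite lee_fin. Qed.

Lemma partial_le_of_series a x (B : R) N :
  (\sum_(i <oo) (lam i `^ a * e i x ^+ 2)%:E <= B%:E)%E ->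
  \sum_(i < N) lam i `^ a * e i x ^+ 2 <= B.
Proof.
rewrite -lee_fin => h; apply: le_trans h.
rewrite -sumEFin -(big_mkord xpredT (term a x)).
by apply: nneseries_lim_ge => i _ _; rewrite lee_fin mulr_ge0 ?powR_ge0 ?sqr_ge0.
Qed.

(* The infimum defining M_alpha is attained: intersect over M_alpha + 1/(n+1). *)
Lemma Malpha_attained a : (Malpha mu lam e a < +oo)%E ->
  {ae mu, forall x, forall N, \sum_(i < N) lam i `^ a * e i x ^+ 2 <= fine (Malpha mu lam e a) ^+ 2}.
Proof.
move=> Mfin; set M := fine _.
have Mf : Malpha mu lam e a \is a fin_num by rewrite ge0_fin_numE// Malpha_ge0.
have M0 : 0 <= M by rewrite fine_ge0// Malpha_ge0.
have H n : {ae mu, forall x, forall N, \sum_(i < N) lam i `^ a * e i x ^+ 2 <= (M + n.+1%:R^-1) ^+ 2}.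
  have n0 : 0 < n.+1%:R^-1 :> R by rewrite invr_gt0.
  have [_ [A [A0 hA] <-]] := lb_ereal_inf_adherent n0 Mf.
  rewrite -/(Malpha mu lam e a) -(fineK Mf) -EFinD lte_fin -/M => Alt.
  apply: filterS hA => x hx N; apply: (@le_trans _ _ (A ^+ 2)).
    exact: partial_le_of_series.
  by apply: lerXn2r; rewrite ?nnegrE//; [rewrite addr_ge0// ltW|exact: ltW].
apply: filterS (ae_foralln H) => x hx N.
have c : (fun n => (M + n.+1%:R^-1) ^+ 2) @ \oo --> (M + 0) ^+ 2.
  have c1 : (fun n => M + n.+1%:R^-1 : R) @ \oo --> M + 0.
    by apply: cvgD; [exact: cvg_cst|exact: cvg_harmonic].
  by rewrite expr2; under eq_fun do rewrite expr2; exact: cvgM.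
rewrite addr0 in c.
by apply: (ler_cvgn (cvg_cst _) c); apply: nearW => n; exact: hx.
Qed.

(** As [lam] is bounded by [lam 0], raising the exponent from [a'] to [a] costs at most the constant
    factor [q]. *)
Lemma Malpha_lty_mono a a' : a' <= a -> (Malpha mu lam e a' < +oo)%E -> (Malpha mu lam e a < +oo)%E.
Proof.
move=> aa /ereal_inf_lt[_ [A [A0 hA] <-] _].
pose q := lam 0 `^ (a - a').
have q0 : 0 <= q by exact: powR_ge0.
have lam_le i : lam i <= lam 0.
  by elim: i => // i IH; exact: le_trans (lamS i) IH.
apply: (@le_lt_trans _ _ (Num.sqrt q * A)%:E); last exact: ltry.
apply: ereal_inf_lbound; exists (Num.sqrt q * A) => //; split.
  by rewrite mulr_ge0 ?sqrtr_ge0.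
apply: filterS hA => x hx; rewrite exprMn sqr_sqrtr// EFinM.
apply: (@le_trans _ _ (q%:E * \sum_(i <oo) (lam i `^ a' * e i x ^+ 2)%:E)%E); last first.
  by rewrite lee_wpmul2l.
rewrite -nneseriesZl//; last by move=> i _; rewrite lee_fin mulr_ge0 ?powR_ge0 ?sqr_ge0.
apply: lee_nneseries => i _.
  by rewrite lee_fin mulr_ge0 ?powR_ge0 ?sqr_ge0.
rewrite -EFinM lee_fin [leRHS]mulrA ler_wpM2r ?sqr_ge0// /q.
rewrite -(@powR_split _ (lam i) (a - a') a' a)//; last by rewrite subrK.
rewrite ler_wpM2r ?powR_ge0//; apply: ge0_ler_powR => //.
- by rewrite subr_ge0.
- by rewrite nnegrE ltW.
- by rewrite nnegrE ltW.
Qed.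

Lemma Malpha_lty beta a : emb_index mu lam e beta < a -> 0 < beta^-1 ->
  beta^-1 <= emb_index mu lam e beta ->
  (Malpha mu lam e a < +oo)%E.
Proof.
move=> ha b0 hb; set E := [set a : R | beta^-1 <= a <= 1 /\ (Malpha mu lam e a < +oo)%E].
(* The infimum of the empty set is 0 by convention, which the positive lower bound [beta^-1] on the
   index excludes. *)
have E0 : E !=set0.
  apply/set0P/negP => /eqP E0; move: hb.
  by rewrite /emb_index -/E E0 inf0 leNgt b0.
have [a' [_ h] a'a] := inf_lt E0 ha.
exact: Malpha_lty_mono (ltW a'a) h.
Qed.

End embedding.

Section eff_dim.
Context {R : realType}.

(* [eff_dim] is a [limn], junk for divergent series: the bound on the partial
   sums of [lam] rules this out. *)
Lemma eff_dim_ge (lam : nat -> R) (nu K : R) N : 0 < nu -> (forall i, 0 < lam i) ->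
  (forall N, \sum_(i < N) lam i <= K) ->
  \sum_(i < N) lam i / (lam i + nu^-1) <= eff_dim lam nu.
Proof.
move=> n0 l0 lK; rewrite /eff_dim /rsum.
have t0 i : 0 <= lam i / (lam i + nu^-1).
  by rewrite divr_ge0 ?addr_ge0 ?invr_ge0// ltW.
have nd : {homo (fun N => \sum_(i < N) lam i / (lam i + nu^-1)) : n m / (n <= m)%N >-> n <= m}.
  by apply/nondecreasing_seqP => n; rewrite big_ord_recr/= lerDl.
apply: (nondecreasing_cvgn_le nd); apply: nondecreasing_is_cvgn => //.
exists (nu * K) => _ [n _ <-]; apply: (@le_trans _ _ (nu * \sum_(i < n) lam i)).
  rewrite mulr_sumr; apply: ler_sum => i _; rewrite ler_pdivrMr; last first.
    by rewrite addr_gt0 ?invr_gt0.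
  rewrite [leRHS](_ : _ = nu * lam i * lam i + lam i); last by field; rewrite gt_eqF.
  by rewrite lerDr !mulr_ge0// ltW.
by rewrite ler_wpM2l// ltW.
Qed.

End eff_dim.

Section hnorm.
Context {R : realType}.

Lemma Hnorm_le (v : nat -> R) (b : R) : 0 <= b -> (forall N, nrm N v <= b) ->
  (Hnorm v <= b%:E)%E.
Proof.
move=> b0 hv; rewrite /Hnorm.
have h : (\sum_(i <oo) (v i ^+ 2)%:E <= (b ^+ 2)%:E)%E.
  apply: lime_le; first by apply: is_cvg_nneseries => i _ _; rewrite lee_fin sqr_ge0.
  apply: nearW => N; rewrite big_mkord sumEFin lee_fin.
  rewrite [leLHS](_ : _ = nrm N v ^+ 2); last by rewrite nrm_sqr; apply: eq_bigr => i _; rewrite expr2.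
  by apply: lerXn2r; rewrite ?nnegrE ?nrm_ge0.
have h0 : (0 <= \sum_(i <oo) (v i ^+ 2)%:E)%E.
  by apply: nneseries_ge0 => i _ _; rewrite lee_fin sqr_ge0.
move: h h0; case: (\sum_(i <oo) _)%E => [r| |]//; rewrite !lee_fin => h h0.
by rewrite -(ger0_norm b0) -sqrtr_sqr ler_wsqrtr.
Qed.

(* Uses 10 <= 8 sqrt 2 and 5 sqrt 2 <= 8. *)
Lemma deviation_bound_le (tau Ma Ft Rad sig L D0 Nn p1 p2 q n sq2 : R) :
  0 <= tau -> 0 <= Ma -> 0 <= sig -> 0 <= Ft -> 0 <= Rad -> 0 <= D0 + L -> 0 <= Nn -> 0 <= p1 -> 0 <= q ->
  0 < n -> p1 * q = p2 -> 0 <= sq2 -> sq2 ^+ 2 = 2 ->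
  n^-1 * (5 * tau * (2 * (Ma * p1) * (D0 + L) + (sq2 * sig * Num.sqrt Nn + 2 * (Ma * p1) * Ft * Rad * q) * Num.sqrt n)) <=
  tau * (8 * sq2 * Ma * p1 / n * (D0 + L) + 8 * sig * Num.sqrt Nn / Num.sqrt n
     + 8 * sq2 * Ma * Ft * Rad * p2 / Num.sqrt n).
Proof.
move=> t0 M0 s0 F0 R0 DL N0 p0 q0 n0 pq sq0 sq.
have sn0 : 0 < Num.sqrt n by rewrite sqrtr_gt0.
have snE : n^-1 * Num.sqrt n = (Num.sqrt n)^-1.
  by rewrite -{1}(sqr_sqrtr (ltW n0)); field; rewrite gt_eqF.
have sqle : sq2 <= 3 / 2 by nra.
have sqge : 5 / 4 <= sq2 by nra.
have u0 : 0 <= n^-1 by rewrite invr_ge0 ltW.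
have v0 : 0 <= (Num.sqrt n)^-1 by rewrite invr_ge0 ltW.
have c1 : 0 <= Ma * p1 * (D0 + L) * n^-1 by rewrite !mulr_ge0.
have c2 : 0 <= sig * Num.sqrt Nn * (Num.sqrt n)^-1 by rewrite !mulr_ge0// sqrtr_ge0.
have c3 : 0 <= Ma * p2 * Ft * Rad * (Num.sqrt n)^-1 by rewrite -pq !mulr_ge0.
rewrite [leLHS](_ : _ = tau * (10 * (Ma * p1 * (D0 + L) * n^-1) +
   5 * sq2 * (sig * Num.sqrt Nn * (n^-1 * Num.sqrt n)) + 10 * (Ma * (p1 * q) * Ft * Rad * (n^-1 * Num.sqrt n)))); last by ring.
rewrite snE pq ler_wpM2l//.
rewrite [leRHS](_ : _ = 8 * sq2 * (Ma * p1 * (D0 + L) * n^-1) + 8 * (sig * Num.sqrt Nn * (Num.sqrt n)^-1)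
   + 8 * sq2 * (Ma * p2 * Ft * Rad * (Num.sqrt n)^-1)); last by ring.
move: c1 c2 c3; move: (_ * n^-1) (sig * _ * _) (_ * Rad * _) => x y z *.
by apply: lerD; [apply: lerD|]; apply: ler_wpM2r => //; lra.
Qed.

End hnorm.

(** * Assembling the estimate *)

Section assembly_aux.
Context {R : realType}.

Lemma nrm_leS N (v : nat -> R) : nrm N v <= nrm N.+1 v.
Proof. by rewrite ler_wsqrtr// /dot big_ord_recr/= lerDl -expr2 sqr_ge0. Qed.

(** Continuity from below keeps the same level [delta] for all [N] at once, so no union bound is
    paid. *)
Lemma ae_forall_coords d (Omega : measurableType d) (P : probability Omega R)
  (v : Omega -> nat -> R) (r delta : R) :
  (forall i, measurable_fun setT (v ^~ i)) ->
  (forall N, (P [set w | (r < nrm N (v w))%R] <= delta%:E)%E) ->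
  exists G, [/\ measurable G, ((1 - delta)%:E <= P G)%E & forall w, G w -> forall N, nrm N (v w) <= r].
Proof.
move=> mv Pv; pose A N := [set w | r < nrm N (v w)].
have mA N : measurable (A N).
  rewrite (_ : A N = (fun w => nrm N (v w)) @^-1` `]r, +oo[%classic).
    apply: measurable_preimage => //; exact: (measurable_nrm (f := fun i w => v w i)) => i _.
  by apply/seteqP; split => w /=; rewrite in_itv/= andbT.
have ndA : nondecreasing_seq A.
  by apply/nondecreasing_seqP => N; apply/subsetPset => w /= h; apply: lt_le_trans h (nrm_leS _ _).
have mU : measurable (\bigcup_N A N) by exact: bigcup_measurable.
have PU : (P (\bigcup_N A N) <= delta%:E)%E.
  have c := nondecreasing_cvg_mu (mu := P) mA mU ndA.
  rewrite -(cvg_lim _ c)//; apply: lime_le; first by apply/cvg_ex; eexists; exact: c.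
  by apply: nearW => N; exact: Pv.
exists (~` \bigcup_N A N); split; first exact: measurableC.
  by rewrite probability_setC// EFinB leeB.
by move=> w Gw N; rewrite leNgt; apply/negP => h; apply: Gw; exists N.
Qed.

Lemma compact_measurable_Rd d (X : set 'rV[R]_d) : compact X -> measurable (X : set (Rd R d)).
Proof.
move=> cX; have clX : closed X.
  apply: compact_closed cX; rewrite ball_hausdorff => x y xy.
  have [i xyi] : exists i, x ord0 i != y ord0 i.
    apply/existsP; rewrite -negb_forall; apply: contra xy => /forallP xy.
    by apply/eqP/rowP => i; apply/eqP.
  (* Half the gap in a distinguishing coordinate is a radius for which the two balls are
     disjoint. *)
  have h : 0 < `|x ord0 i - y ord0 i| / 2 by rewrite divr_gt0// normr_gt0 subr_eq0.
  exists (PosNum h, PosNum h) => /=.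
  apply/eqP/seteqP; split => // z [].
  rewrite /ball/= /mx_ball => -[_ /(_ ord0 i)] + [_ /(_ ord0 i)]; rewrite /ball/= => h1 h2.
  have := ler_distD (z ord0 i) (x ord0 i) (y ord0 i).
  by rewrite (distrC (z ord0 i)); lra.
rewrite -[X]setCK; apply: measurableC; apply: sub_sigma_algebra.
exact: closed_openC.
Qed.

End assembly_aux.

Section feature_norm.
Context {R : realType} {T : Type}.

Lemma nrm_feature (lam : nat -> R) (u : nat -> R) (nu c : R) N : 0 < nu -> (forall i, 0 < lam i) ->
  nrm N (fun i => c * (Num.sqrt (lam i) * u i) / Num.sqrt (lam i + nu^-1)) =
  `|c| * Num.sqrt (\sum_(i < N) lam i * u i ^+ 2 / (lam i + nu^-1)).
Proof.
move=> n0 l0.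
rewrite (_ : (fun i => _) = c \*o (fun i => Num.sqrt (lam i) * u i / Num.sqrt (lam i + nu^-1))); last first.
  by apply/funext => i /=; rewrite !mulrA.
rewrite nrmZ; congr (_ * Num.sqrt _); apply: eq_bigr => i _.
have q : Num.sqrt (lam i) ^+ 2 = lam i by rewrite sqr_sqrtr// ltW.
have l1 : 0 < lam i + nu^-1 by rewrite addr_gt0 ?invr_gt0.
have q1 : Num.sqrt (lam i + nu^-1) ^+ 2 = lam i + nu^-1 by rewrite sqr_sqrtr// ltW.
by rewrite -expr2 !exprMn exprVn q q1.
Qed.

End feature_norm.

Unset Implicit Arguments.
Theorem theorem13
  (R : realType) (d : nat)
  (* input space X subset R^d, compact *)
  (X : set 'rV[R]_d) (hXc : compact X)
  (* the distribution rho on X x Y (Y a subset of R), marginal mu *)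
  (rho : probability (Rd R d * R)%type R)
  (hrhoX : rho (X `*` setT) = 1%E)
  (hy2 : rho.-integrable setT (fun z => ((z.2) ^+ 2)%:E))
  (mu : {measure set (Rd R d) -> \bar R})
  (hmu : forall A, measurable A -> mu A = rho (A `*` setT))
  (* the kernel k, continuous, bounded by kappa^2 on the diagonal *)
  (k : 'rV[R]_d -> 'rV[R]_d -> R) (kappa : R)
  (hkcont : {within X `*` X, continuous (fun p : 'rV[R]_d * 'rV[R]_d => k p.1 p.2)})
  (hkbd : forall x, X x -> k x x <= kappa ^+ 2)
  (* spectral data: lambda_i positive non-increasing, (e_i) orthonormal in L^2(mu),
     (lambda_i^{1/2} e_i) an ONB of H, i.e. k(x,x') = sum_i lambda_i e_i(x) e_i(x') *)
  (lam : nat -> R) (e : nat -> Rd R d -> R)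
  (hlam_pos : forall i, 0 < lam i) (hlam_noninc : forall i, lam i.+1 <= lam i)
  (he_meas : forall i, measurable_fun setT (e i))
  (he_L2 : forall i, mu.-integrable setT (fun x => ((e i x) ^+ 2)%:E))
  (he_orth : forall i j, L2inner mu (e i) (e j) = (i == j)%:R)
  (hmercer : forall x x', X x -> X x' ->
     (fun N : nat => \sum_(i < N) lam i * e i x * e i x') @ \oo --> k x x')
  (* the filter function phi_nu, with constants E, F_tau, qualification tau >= 1 *)
  (phi : R -> R -> R) (Ef Ft tau : R) (htau : 1 <= tau)
  (hphi_pos : forall nu z, 0 < nu -> 0 <= z <= kappa ^+ 2 -> 0 <= phi nu z)
  (hphiE : forall nu a z, 0 < nu -> 0 <= a <= 1 -> 0 <= z <= kappa ^+ 2 ->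
     z `^ a * phi nu z <= Ef * nu `^ (1 - a))
  (hphiF : forall nu a z, 0 < nu -> 0 <= a <= tau -> 0 <= z <= kappa ^+ 2 ->
     `|1 - z * phi nu z| * z `^ a <= Ft * nu `^ (- a))
  (* (EDR) *)
  (beta c C : R) (hbeta : 1 < beta) (hc : 0 < c) (hC : 0 < C)
  (hEDR : forall i : nat, c * (i.+1%:R) `^ (- beta) <= lam i <= C * (i.+1%:R) `^ (- beta))
  (* embedding index *)
  (hemb : beta^-1 <= emb_index mu lam e beta < 1)
  (* regression function f_rho^*(x) = int y d rho(y|x) *)
  (fstar : Rd R d -> R) (hfstar_meas : measurable_fun setT fstar)
  (hfstar : forall A, measurable A ->
     Rintegral rho (A `*` setT) (fun z => z.2) = Rintegral mu A fstar)
  (* (Source) *)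
  (s Rad : R) (hs : 0 < s <= 2 * tau) (hRad : 0 < Rad)
  (hsource : exists a : nat -> R,
     (\sum_(i <oo) ((a i) ^+ 2)%:E <= (Rad ^+ 2)%:E)%E /\
     (fun N : nat => (\int[mu]_x
        ((fstar x - \sum_(i < N) a i * lam i `^ (s / 2) * e i x) ^+ 2)%:E)%E)
       @ \oo --> 0%E)
  (* (Noise) *)
  (sigma L : R) (hsigma : 0 < sigma) (hL : 0 < L)
  (hnoise : forall m : nat, (2 <= m)%N -> forall A, measurable A ->
     (\int[rho]_(z in A `*` setT) (`|z.2 - fstar z.1| ^+ m)%:E
       <= ((m`!)%:R / 2 * sigma ^+ 2 * L ^+ (m - 2))%:E * mu A)%E)
  (* parameters *)
  (nu t : R) (hnu : 0 < nu) (ht : 0 < t)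
  (* the i.i.d. sample (x_i, y_i), i = 1..n, drawn from rho *)
  (dO : measure_display) (Omega : measurableType dO) (P : probability Omega R)
  (n : nat) (hn : (0 < n)%N) (Z : 'I_n -> Omega -> (Rd R d * R)%type)
  (hZmeas : forall j, measurable_fun setT (Z j))
  (hZlaw : forall j A, measurable A -> P (Z j @^-1` A) = rho A)
  (hZindep : mutual_indep P Z) :
  let Omega0 : set (Rd R d) := [set x | X x /\ `|fstar x| <= t] in
  let xi := xi_coord mu lam e phi nu fstar in
  forall alpha : R, emb_index mu lam e beta < alpha <= 1 ->
  forall delta : R, 0 < delta < 1 ->
  let Ma := fine (Malpha mu lam e alpha) in
  let Mt := Ma * (Ef + Ft) * Rad * nu `^ ((alpha - s) / 2) + t + L in
  let C1 := 8 * Num.sqrt 2 * Ma in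
  let C2 := 8 * sigma in
  let C3 := 8 * Num.sqrt 2 * Ma * Ft * Rad in
  let bound := ln (2 / delta) *
     (C1 * nu `^ (alpha / 2) / n%:R * Mt
      + C2 * Num.sqrt (eff_dim lam nu) / Num.sqrt n%:R
      + C3 * nu `^ ((alpha - s) / 2) / Num.sqrt n%:R) in
  exists G : set Omega, measurable G /\ (P G >= (1 - delta)%:E)%E /\
    forall w, G w ->
      (Hnorm (fun i =>
         (n%:R^-1 * \sum_(j < n) xi i (Z j w) * \1_Omega0 (Z j w).1
          - Rintegral rho setT (fun z => xi i z * \1_Omega0 z.1))%R)
       <= bound%:E)%E.
Proof.
move=> Omega0 xi alpha /andP[halpha0 alpha1] delta /andP[d0 d1] Ma Mt C1 C2 C3 bound.
have [b0 b1] := andP hemb; have [s0 stau] := andP hs.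
have binv : 0 < beta^-1 by rewrite invr_gt0 (lt_trans ltr01).
have al0 : 0 < alpha := lt_trans (lt_le_trans binv b0) halpha0.
have mX := compact_measurable_Rd hXc.
have muX : mu (~` X) = 0%E.
  rewrite hmu; last exact: measurableC.
  rewrite (_ : (~` X) `*` setT = ~` (X `*` setT)); last first.
    by apply/seteqP; split => z /=; [move=> [nX _] []//|move=> nX; split => // zX; exact: nX].
  by rewrite probability_setC ?hrhoX ?subee//; exact: measurableX.
have aeX : {ae mu, forall x, X x}.
  by exists (~` X); split => //; exact: measurableC.
have mu1 : mu setT = 1%E by rewrite hmu// setXTT; exact: probability_setT.
have kb x N : X x -> \sum_(i < N) lam i * e i x ^+ 2 <= kappa ^+ 2.
  move=> Xx; apply: le_trans (hkbd _ Xx).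
  have nd : {homo (fun N => \sum_(i < N) lam i * e i x * e i x) : n m / (n <= m)%N >-> n <= m}.
    apply/nondecreasing_seqP => m; rewrite big_ord_recr/= lerDl -mulrA.
    by rewrite mulr_ge0 ?(ltW (hlam_pos m))// -expr2 sqr_ge0.
  have c1 := hmercer x x Xx Xx.
  rewrite -(cvg_lim _ c1)//; apply: le_trans (nondecreasing_cvgn_le nd _ N).
    by apply: ler_sum => i _; rewrite expr2 mulrA.
  by apply/cvg_ex; eexists; exact: c1.
have me2 i : measurable_fun setT (fun x => e i x ^+ 2) by exact: measurable_funX.
(* Integrating the diagonal Mercer bound gives a trace bound: it places every [lam i] in the domain
   of the filter and makes [eff_dim] a convergent sum. *)
have lamsum N : \sum_(i < N) lam i <= kappa ^+ 2.
  rewrite -lee_fin -(integral_diag he_meas he_L2 he_orth N (fun i => ltW (hlam_pos i))).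
  apply: (@le_trans _ _ (\int[mu]_x (kappa ^+ 2)%:E)%E).
    apply: ae_ge0_le_integral => //.
    - move=> x _; rewrite lee_fin; apply: sumr_ge0 => i _.
      by rewrite mulr_ge0 ?sqr_ge0// ltW.
    - apply/measurable_EFinP; apply: measurable_sum => i; exact: measurable_funM.
    - by move=> x _; rewrite lee_fin sqr_ge0.
    - have [NX [mNX NX0 XN]] := aeX; exists NX; split=> // x /= hx; apply: XN => /= Xx; apply: hx => _.
      by rewrite lee_fin kb.
  by rewrite (integral_cst mu measurableT (kappa ^+ 2)%:E) mu1 mule1.
have lamk i : lam i <= kappa ^+ 2.
  apply: le_trans (lamsum i.+1); rewrite big_ord_recr/= lerDr.
  by apply: sumr_ge0 => j _; rewrite ltW.
have [a [aR fA]] := hsource.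
have aRad N : dot N a a <= Rad ^+ 2.
  rewrite -lee_fin; apply: le_trans aR.
  rewrite (_ : (dot N a a)%:E = \sum_(0 <= i < N) (a i ^+ 2)%:E)%E; last first.
    by rewrite big_mkord sumEFin.
  by apply: nneseries_lim_ge => i _ _; rewrite lee_fin sqr_ge0.
have Mfin : (Malpha mu lam e alpha < +oo)%E.
  exact: (Malpha_lty hlam_pos hlam_noninc halpha0 binv b0).
have good := Malpha_attained Mfin.
have Ma0 : 0 <= Ma by rewrite fine_ge0// Malpha_ge0.
pose phi0 z hz := hphi_pos nu z hnu hz.
pose phiE b z hb hz := hphiE nu b z hnu hb hz.
pose phiF b z hb hz := hphiF nu b z hnu hb hz.
set fn := fnu mu lam e phi nu fstar.
have mfn : measurable_fun setT fn.
  exact: (measurable_f_nu hlam_pos he_meas he_L2 he_orth phi nu hfstar_meas fA).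
have Ef0 : 0 <= Ef := Ef_ge0 hlam_pos lamk phi0 phiE.
have Ft0 : 0 <= Ft := Ft_ge0 hlam_pos lamk phiF htau.
(* With this choice [D0 + L] is [Mt]. *)
set D0 := Ma * (Ef + Ft) * Rad * nu `^ ((alpha - s) / 2) + t.
have D00 : 0 <= D0.
  by rewrite addr_ge0 ?(ltW ht)// !mulr_ge0 ?addr_ge0 ?powR_ge0// ltW.
have res := ae_residual_le hlam_pos he_meas he_L2 he_orth lamk phi0 phiE phiF
  hfstar_meas htau s0 stau (ltW hRad) aRad al0 alpha1 Ma0 fA good (ltW ht).
have ires := integral_residual_le hlam_pos he_meas he_L2 he_orth lamk phi0 phiE phiF
  hfstar_meas htau s0 stau (ltW hRad) aRad al0 alpha1 Ma0 fA good.
set V := 2 * (Ft * Rad * nu `^ (- (s / 2))) ^+ 2 in ires.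
have V0 : 0 <= V by rewrite mulr_ge0// sqr_ge0.
set H := Ma * nu `^ (alpha / 2).
have H0 : 0 <= H by rewrite mulr_ge0// powR_ge0.
have HE : H ^+ 2 = Ma ^+ 2 * nu `^ alpha.
  by rewrite exprMn powR_sqr// (_ : 2 * (alpha / 2) = alpha)//; field.
set Nn := eff_dim lam nu.
have Nle N : \sum_(i < N) lam i / (lam i + nu^-1) <= Nn.
  exact: (eff_dim_ge N hnu hlam_pos lamsum).
(* Strict positivity, from the first eigenvalue, makes [S] positive as [bernstein] requires. *)
have Nn0 : 0 < Nn.
  apply: lt_le_trans (Nle 1); rewrite big_ord1.
  by rewrite divr_gt0 ?addr_gt0 ?invr_gt0.
(* A sum rather than the root of a sum of squares, so that the bound splits into the [C2] and [C3]
   terms; the cross term of its square is discarded. *)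
set S := Num.sqrt 2 * sigma * Num.sqrt Nn + 2 * H * Ft * Rad * nu `^ (- (s / 2)).
have S1 : 0 < Num.sqrt 2 * sigma * Num.sqrt Nn by rewrite !mulr_gt0// sqrtr_gt0.
have S2 : 0 <= 2 * H * Ft * Rad * nu `^ (- (s / 2)).
  by rewrite !mulr_ge0 ?powR_ge0// ltW.
have S0 : 0 < S by rewrite ltr_wpDr.
have sq2 : Num.sqrt 2 ^+ 2 = 2 :> R by rewrite sqr_sqrtr.
have hS : 2 * sigma ^+ 2 * Nn + 2 * H ^+ 2 * V <= S ^+ 2.
  have e1 : 2 * sigma ^+ 2 * Nn = (Num.sqrt 2 * sigma * Num.sqrt Nn) ^+ 2.
    by rewrite !exprMn sq2 sqr_sqrtr// ltW.
  have e2 : 2 * H ^+ 2 * V = (2 * H * Ft * Rad * nu `^ (- (s / 2))) ^+ 2.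
    by rewrite /V; ring.
  by rewrite e1 e2 /S sqrrD lerD2r lerDl mulrn_wge0// mulr_ge0// ltW.
have mO : measurable Omega0.
  rewrite (_ : Omega0 = X `&` (fun x => `|fstar x|) @^-1` `]-oo, t]%classic); last first.
    by apply/seteqP; split => x /=; rewrite in_itv.
  apply: measurableI => //; apply: measurable_preimage => //; exact: measurableT_comp.
pose g i (z : Rd R d * R) := xi i z * \1_Omega0 z.1.
have mg i : measurable_fun setT (g i).
  apply: measurable_funM; last first.
    exact: (measurableT_comp (measurable_indic mO) measurable_fst).
  apply: measurable_funM => //; apply: measurable_funM.
    apply: measurable_funB; first exact: measurable_snd.
    exact: (measurableT_comp mfn measurable_fst).
  apply: measurable_funM => //; exact: (measurableT_comp (he_meas i) measurable_fst).
pose h2 N (x : Rd R d) := \sum_(i < N) lam i * e i x ^+ 2 / (lam i + nu^-1).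
have mh2 N : measurable_fun setT (h2 N).
  by apply: measurable_sum => i; apply: measurable_funM => //; exact: measurable_funM.
have h20 N x : 0 <= h2 N x.
  apply: sumr_ge0 => i _; have li := ltW (hlam_pos i); have nui := ltW hnu.
  by apply: divr_ge0; [apply: mulr_ge0 => //; exact: sqr_ge0|rewrite addr_ge0 ?invr_ge0].
have gE N z : nrm N (g ^~ z) = `|(z.2 - fn z.1) * \1_Omega0 z.1| * Num.sqrt (h2 N z.1).
  rewrite -(nrm_feature (e ^~ z.1) _ N hnu hlam_pos); congr nrm; apply/funext => i.
  by rewrite /g /xi /xi_coord -/fn; ring.
have moments N m : (2 <= m)%N ->
    (\int[rho]_z (nrm N (g ^~ z) ^+ m)%:E <= (m`!%:R / 2 * S ^+ 2 * (2 * H * (D0 + L)) ^+ (m - 2))%:E)%E.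
  apply: (moment_le (h2 := h2 N) (t := t) (fn := fn) hmu hfstar_meas mfn (mh2 N) _ (h20 N) _ _ res ires
    (fun z => nrm_ge0 N _) _ _ (ltW hL) H0 D00 (ltW Nn0) V0 hnoise hS).
  - by apply: (measurable_nrm (f := g)) => i _.
  - have [NX [mNX NX0 XN]] := good; exists NX; split=> // x /= hx; apply: XN => /= gx; apply: hx.
    by rewrite HE; exact: (good_feature hlam_pos hnu al0 alpha1 N gx).
  - by rewrite (integral_feature hlam_pos he_meas he_L2 he_orth hnu N) lee_fin.
  - move=> z tz; rewrite gE indicE memNset ?mulr0 ?normr0 ?mul0r//.
    by rewrite /Omega0 /= => -[_]; rewrite leNgt tz.
  - move=> z; rewrite gE ler_wpM2r ?sqrtr_ge0// normrM -[leRHS]mulr1 ler_wpM2l//.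
    by rewrite indicE; case: (_ \in _); rewrite ?normr1 ?normr0.
case: n hn Z hZmeas hZlaw hZindep @bound => // n' hn Z hZmeas hZlaw hZindep bound.
(* The sample is extended to all natural indices; [inord] returns a default beyond the sample size,
   where no intersection or sum below looks. *)
pose Zn (j : nat) := Z (inord j).
have Znindep A : (forall j, measurable (A j)) ->
    P (\bigcap_(j < n'.+1) (Zn j @^-1` A j)) = (\prod_(j < n'.+1) fine (rho (A j)))%:E.
  move=> mA; have mI : measurable (\bigcap_(j < n'.+1) (Zn j @^-1` A j)).
    by apply: bigcap_measurableType => j _; apply: measurable_preimage (mA j); exact: hZmeas.
  rewrite -[LHS]fineK ?fin_num_measure//; congr EFin.
  rewrite (eq_bigr (fun j : 'I_n'.+1 => fine (P (Z j @^-1` A j)))); last first.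
    by move=> j _; rewrite hZlaw.
  rewrite -(hZindep (fun j => A j))//; congr (fine (P _)).
  apply/seteqP; split => w Hw j /=.
    by move=> _; have := Hw j (ltn_ord j); rewrite /Zn /= inord_val.
  by move=> jn; have := Hw (inord j) I; rewrite /Zn /= inordK.
have DL0 : 0 <= D0 + L by apply: addr_ge0 => //; exact: ltW.
have B0 : 0 <= 2 * H * (D0 + L) by apply: mulr_ge0 => //; apply: mulr_ge0.
have d01 : 0 < delta < 1 by rewrite d0.
pose dev w i := \sum_(j < n'.+1) gcent rho g (Zn j w) i.
have mdev i : measurable_fun setT (dev ^~ i).
  apply: measurable_sum => j; apply: measurable_funB => //.
  exact: (measurableT_comp (mg i) (hZmeas _)).
have [G [mG PG GP]] := ae_forall_coords mdev
  (fun N => bernstein hn (fun j => hZmeas _) Znindep mg S0 B0 d01 (moments N)).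
exists G; split => //; split => // w Gw.
have t0 : 0 <= ln (2 / delta).
  by rewrite ln_ge0// ler_pdivlMr//; lra.
have n0 : 0 < n'.+1%:R :> R by rewrite ltr0n.
set r := 5 * _ * _ in GP.
have rb : n'.+1%:R^-1 * r <= bound.
  have pq : nu `^ (alpha / 2) * nu `^ (- (s / 2)) = nu `^ ((alpha - s) / 2).
    by apply: powR_split => //; field.
  exact: (deviation_bound_le t0 Ma0 (ltW hsigma) Ft0 (ltW hRad) DL0 (ltW Nn0) (powR_ge0 _ _)
    (powR_ge0 _ _) n0 pq (sqrtr_ge0 2) sq2).
have r0 : 0 <= r.
  apply: mulr_ge0; first exact: mulr_ge0.
  by apply: addr_ge0 => //; apply: mulr_ge0; [exact: ltW|exact: sqrtr_ge0].
apply: Hnorm_le; first by apply: le_trans rb; rewrite mulr_ge0// invr_ge0 ltW.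
move=> N; apply: le_trans rb.
rewrite (_ : (fun i => _) = n'.+1%:R^-1 \*o dev w); last first.
  apply/funext => i /=; rewrite /dev /gcent sumrB sumr_const card_ord mulrBr; congr (_ - _).
    by congr (_ * _); apply: eq_bigr => j _; rewrite /g /Zn inord_val.
  by rewrite -(mulr_natl (gmean rho g i)) mulrA mulVf ?mul1r ?gt_eqF.
rewrite nrmZ ger0_norm ?invr_ge0 ?(ltW n0)//.
by rewrite ler_wpM2l ?invr_ge0 ?(ltW n0)//; exact: GP.
Qed.
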